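(* Let $m\geq 1$ be any positive odd integer. Then $$\sum_{n=1}^{\infty}(-1)^{n+1}H_n\sum_{p=0}^{m-1}\left[\frac{(-1)^p}{4mn+4p+3}+\frac{(-1)^p}{4mn+4p+1}\right]=\frac{m}{16}\left(\psi'(7/8)-\psi'(3/8)\right)-\frac{\pi^2m\sqrt{2}}{8}+\frac{\pi (m+2)\sqrt{2}}{4}\log 2+\frac{\pi\sqrt{2}}{4}\Bigg\{\sum_{k=0}^{\frac{m-3}{2}}\log\left(1+\sqrt{\frac{1-\varphi_k}{2}}\right)+2\sum_{k=0}^{\frac{m-3}{2}}\log\left(\sqrt{2}+\sqrt{1+\sqrt{\frac{1-\varphi_k}{2}}}\right)\Bigg\}.$$
   Context: $H_n=1+\frac12+\cdots+\frac1n$ is the $n$th harmonic number; $\psi=\Gamma'/\Gamma$ is the digamma function and $\psi'$ its derivative. For given $m$, $\varphi_k=\cos\left(\frac{(2k+1)\pi}{m}\right)$. An empty sum $\sum_{k=0}^{-1}(\cdot)$ is taken to be zero. *)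

(* Defs.v *)
From Stdlib Require Import Reals List.
From Coquelicot Require Import Coquelicot.
Open Scope R_scope.

(* f 0 + ... + f (n - 1).  The bound is exclusive, so that n = 0 gives the empty
   sum; a sum with upper limit (m - 3) / 2, m odd, is [sum_lt f ((m - 1) / 2)],
   which avoids the truncated natural subtraction m - 3 at m = 1. *)
Definition sum_lt (f : nat -> R) (n : nat) : R :=
  fold_right Rplus 0 (map f (seq 0 n)).

Definition harmonic (n : nat) : R := sum_lt (fun k => / INR (k + 1)) n.

(* Euler's integral; meaningful for x > 0, where it converges. *)
Definition Gamma (x : R) : R :=
  RInt_gen (fun t => Rpower t (x - 1) * exp (- t))
           (at_right 0) (Rbar_locally p_infty).

Definition digamma (x : R) : R := Derive Gamma x / Gamma x.

Definition trigamma (x : R) : R := Derive digamma x.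

Definition phi (m k : nat) : R := cos ((2 * INR k + 1) * PI / INR m).

(* Main.v *)
Require Import Defs.
From Stdlib Require Import Reals Arith List Lra Lia.
From Coquelicot Require Import Coquelicot.
Open Scope R_scope.

(* Since [(1 + y) sum (-1)^(n+1) H_n y^n = ln (1 + y)], integrating with [y = x^(4m)]
   termwise turns the series into the integral over [0, 1] of
   [(1 + x^2) / (1 + x^4) * ln (1 + x^(4m))].  For odd [m], [1 + x^(4m)] is a product of
   factors [D_a = (1 - x^2)^2 + a^2 x^2]: one with [a = sqrt 2], and two for each [phi_k].
   The integral [H(a)] of [(1 + x^2) / (1 + x^4) * ln D_a] has derivative
   [(pi / sqrt 2) / (a + sqrt 2)], so [H(a) = (pi / sqrt 2) ln (a + sqrt 2) - C], and the
   behaviour as [a] tends to infinity identifies [C] with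
   [2 sum (1/(8k+1)^2 + 1/(8k+3)^2 - 1/(8k+5)^2 - 1/(8k+7)^2)].  The trigamma series,
   read off Gauss's product for Gamma, and the reflection formula then give [C]. *)

(** * Finite sums and calculus *)

(** Two obstacles shape the proof. The generating series of the harmonic numbers has unbounded terms
    at [y = 1], so it cannot be integrated over [0, 1] by uniform convergence. Every expansion is
    therefore kept as a finite identity with an explicit remainder, and only the integrated
    remainder is sent to 0; for the main series it is of order [harmonic N / N]. [Gamma] is an
    improper integral and [Derive] is total, so [digamma] and [trigamma] mean nothing until
    differentiability is proved. Differentiation under the improper integral is avoided: [ln Gamma]
    is a pointwise limit of elementary functions, and uniform bounds on one further derivative carry
    differentiability to the limit, once for [digamma] and once more for [trigamma]. The constant
    [C] involves trigamma at 1/8, 3/8, 5/8 and 7/8. Reflection trades the values at 1/8 and 5/8 for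
    those at 7/8 and 3/8, and this exchange produces the term in [PI ^ 2]. *)

Lemma sum_lt_S (f : nat -> R) (n : nat) : sum_lt f (S n) = sum_lt f n + f n.
Proof.
  assert (H : forall l x, fold_right Rplus x l = fold_right Rplus 0 l + x).
  { induction l as [|y l IH]; intro x; simpl; [ring|rewrite IH; ring]. }
  unfold sum_lt. rewrite seq_S, map_app, fold_right_app. simpl.
  rewrite H. ring.
Qed.

Lemma sum_lt_ext (f h : nat -> R) (n : nat) :
  (forall k, (k < n)%nat -> f k = h k) -> sum_lt f n = sum_lt h n.
Proof.
  induction n as [|n IH]; intro H; [reflexivity|].
  rewrite !sum_lt_S, IH, (H n) by (intros; try apply H; lia). reflexivity.
Qed.

Lemma sum_lt_le (f h : nat -> R) (n : nat) :
  (forall k, (k < n)%nat -> f k <= h k) -> sum_lt f n <= sum_lt h n.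
Proof.
  induction n as [|n IH]; intro H; [apply Rle_refl|].
  rewrite !sum_lt_S. apply Rplus_le_compat; [apply IH; intros|]; apply H; lia.
Qed.

Lemma sum_lt_plus (f h : nat -> R) (n : nat) :
  sum_lt (fun k => f k + h k) n = sum_lt f n + sum_lt h n.
Proof.
  induction n as [|n IH]; [unfold sum_lt; simpl; ring|].
  rewrite !sum_lt_S, IH; ring.
Qed.

Lemma sum_lt_scal (c : R) (f : nat -> R) (n : nat) :
  sum_lt (fun k => c * f k) n = c * sum_lt f n.
Proof.
  induction n as [|n IH]; [unfold sum_lt; simpl; ring|].
  rewrite !sum_lt_S, IH; ring.
Qed.

Lemma sum_lt_const (c : R) (n : nat) : sum_lt (fun _ => c) n = INR n * c.
Proof.
  induction n as [|n IH]; [unfold sum_lt; simpl; ring|].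
  rewrite sum_lt_S, IH, S_INR; ring.
Qed.

Lemma sum_lt_add (f : nat -> R) (n p : nat) :
  sum_lt f (n + p) = sum_lt f n + sum_lt (fun k => f (n + k)%nat) p.
Proof.
  induction p as [|p IH].
  - rewrite Nat.add_0_r. unfold sum_lt; simpl; ring.
  - rewrite Nat.add_succ_r, !sum_lt_S, IH. ring.
Qed.

Lemma sum_lt_S_l (f : nat -> R) (n : nat) :
  sum_lt f (S n) = f 0%nat + sum_lt (fun k => f (S k)) n.
Proof.
  change (S n) with (1 + n)%nat.
  rewrite sum_lt_add. unfold sum_lt at 1; simpl. ring.
Qed.

Lemma sum_lt_rev (f : nat -> R) (n : nat) :
  sum_lt (fun k => f (n - 1 - k)%nat) n = sum_lt f n.
Proof.
  induction n as [|n IH]; [reflexivity|].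
  rewrite sum_lt_S_l, (sum_lt_S f), <- IH.
  replace (S n - 1 - 0)%nat with n by lia. rewrite Rplus_comm. f_equal.
  apply sum_lt_ext; intros k Hk. f_equal; lia.
Qed.

Lemma sum_n_sum_lt (a : nat -> R) (n : nat) : sum_n a n = sum_lt a (S n).
Proof.
  induction n as [|n IH].
  - rewrite sum_O. unfold sum_lt; simpl; ring.
  - rewrite sum_Sn, sum_lt_S, IH. reflexivity.
Qed.

Lemma is_series_sum_lt (a : nat -> R) (l : R) :
  is_lim_seq (sum_lt a) l -> is_series a l.
Proof.
  intro H. apply is_lim_seq_incr_1 in H.
  apply (is_lim_seq_ext _ (sum_n a)) in H; [exact H|].
  intro n. symmetry. apply sum_n_sum_lt.
Qed.

Lemma is_RInt_sum_lt (f : nat -> R -> R) (a b : R) (l : nat -> R) (n : nat) :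
  (forall k, (k < n)%nat -> is_RInt (f k) a b (l k)) ->
  is_RInt (fun x => sum_lt (fun k => f k x) n) a b (sum_lt l n).
Proof.
  induction n as [|n IH]; intro H.
  - unfold sum_lt; simpl.
    replace (is_RInt (fun _ => 0) a b 0)
      with (is_RInt (fun _ => 0) a b ((b - a) * 0)) by (f_equal; ring).
    exact (is_RInt_const a b (0 : R)).
  - rewrite sum_lt_S.
    apply (is_RInt_ext (fun x => plus (sum_lt (fun k => f k x) n) (f n x))).
    { intros x _. rewrite sum_lt_S. reflexivity. }
    apply (is_RInt_plus (V:=R_NormedModule)); [apply IH; intros|]; apply H; lia.
Qed.

Lemma is_derive_sum_lt (f f' : nat -> R -> R) (n : nat) (x : R) :
  (forall k, (k < n)%nat -> is_derive (f k) x (f' k x)) ->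
  is_derive (fun x => sum_lt (fun k => f k x) n) x (sum_lt (fun k => f' k x) n).
Proof.
  induction n as [|n IH]; intro H.
  - unfold sum_lt; simpl. apply (is_derive_const (K:=R_AbsRing) (V:=R_NormedModule) 0).
  - rewrite sum_lt_S.
    apply (is_derive_ext (fun x => plus (sum_lt (fun k => f k x) n) (f n x))).
    { intros t. rewrite sum_lt_S. reflexivity. }
    apply (is_derive_plus (K:=R_AbsRing) (V:=R_NormedModule)); [apply IH; intros|]; apply H; lia.
Qed.

Lemma derive_nonneg_le (f f' : R -> R) (a b : R) :
  a <= b ->
  (forall t, a <= t <= b -> is_derive f t (f' t)) ->
  (forall t, a <= t <= b -> 0 <= f' t) -> f a <= f b.
Proof.
  intros Hab Hd Hp.
  destruct (MVT_gen f a b f') as [c [Hc E]].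
  - intros x Hx. rewrite Rmin_left, Rmax_right in Hx by lra. apply Hd; lra.
  - intros x Hx. rewrite Rmin_left, Rmax_right in Hx by lra.
    apply continuity_pt_filterlim, (ex_derive_continuous f). exists (f' x). apply Hd; lra.
  - rewrite Rmin_left, Rmax_right in Hc by lra.
    assert (0 <= f' c * (b - a)) by (apply Rmult_le_pos; [apply Hp|]; lra). lra.
Qed.

(** Both [h - f] and [h + f] are nondecreasing. The varying majorant [h] lets this serve for
    remainder estimates that would otherwise need integrals, and [h] constant gives constancy of
    [f]. *)
Lemma abs_le_of_derive (f h f' h' : R -> R) (a b : R) :
  a <= b ->
  (forall t, a <= t <= b -> is_derive f t (f' t)) ->
  (forall t, a <= t <= b -> is_derive h t (h' t)) ->
  (forall t, a <= t <= b -> Rabs (f' t) <= h' t) ->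
  Rabs (f b - f a) <= h b - h a.
Proof.
  intros Hab Hf Hh Hb.
  assert (H1 : h a - f a <= h b - f b).
  { apply (derive_nonneg_le (fun t => h t - f t) (fun t => h' t - f' t)); trivial.
    - intros t Ht. apply (is_derive_minus (K:=R_AbsRing) (V:=R_NormedModule)); auto.
    - intros t Ht. specialize (Hb t Ht). pose proof (Rle_abs (f' t)). lra. }
  assert (H2 : h a + f a <= h b + f b).
  { apply (derive_nonneg_le (fun t => h t + f t) (fun t => h' t + f' t)); trivial.
    - intros t Ht. apply (is_derive_plus (K:=R_AbsRing) (V:=R_NormedModule)); auto.
    - intros t Ht. specialize (Hb t Ht). pose proof (Rle_abs (- f' t)).
      rewrite Rabs_Ropp in H. lra. }
  apply Rabs_le; lra.
Qed.

Lemma is_lim_seq_bound (u e : nat -> R) (l : R) :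
  (forall n, Rabs (u n - l) <= e n) -> is_lim_seq e 0 -> is_lim_seq u l.
Proof.
  intros Hb He.
  apply (is_lim_seq_le_le (fun n => l - e n) _ (fun n => l + e n)).
  - intro n. specialize (Hb n). apply Rabs_le_between in Hb. lra.
  - apply (is_lim_seq_minus' (fun _ => l) e l 0 (is_lim_seq_const l)) in He.
    rewrite Rminus_0_r in He. exact He.
  - apply (is_lim_seq_plus' (fun _ => l) e l 0 (is_lim_seq_const l)) in He.
    rewrite Rplus_0_r in He. exact He.
Qed.

Lemma is_lim_seq_inv_INR : is_lim_seq (fun n => / (INR n + 1)) 0.
Proof.
  apply (is_lim_seq_ext (fun n => / INR (S n))).
  { intro n. rewrite S_INR. reflexivity. }
  apply (is_lim_seq_incr_1 (fun n => / INR n)).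
  replace (Finite 0) with (Rbar_inv p_infty) by reflexivity.
  apply is_lim_seq_inv; [apply is_lim_seq_INR|discriminate].
Qed.

(** * Euler's integral *)

Lemma ln_le_minus_1 (u : R) : 0 < u -> ln u <= u - 1.
Proof.
  intro Hu. pose proof (exp_ineq1_le (ln u)) as H. rewrite (exp_ln u Hu) in H. lra.
Qed.

Lemma exp_le_mono (u v : R) : u <= v -> exp u <= exp v.
Proof.
  intros [H| ->]; [apply Rlt_le, exp_increasing, H|apply Rle_refl].
Qed.

Lemma ball_R (x y : R) (e : posreal) : ball x e y -> x - e < y < x + e.
Proof.
  intro H. change (Rabs (y - x) < e) in H. apply Rabs_def2 in H. lra.
Qed.

(** For a nonnegative integrand the integral grows with the interval, so the supremum over all
    compact intervals is the limit: every interval containing a nearly optimal one is nearly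
    optimal. *)
Lemma RInt_gen_bounded (f : R -> R) (M : R) :
  (forall t, 0 < t -> continuous f t) ->
  (forall t, 0 < t -> 0 <= f t) ->
  (forall a b, 0 < a -> a <= b -> RInt f a b <= M) ->
  exists l, is_RInt_gen f (at_right 0) (Rbar_locally p_infty) l.
Proof.
  intros Hc Hp HM.
  assert (Hi : forall a b, 0 < a -> a <= b -> ex_RInt f a b).
  { intros a b Ha Hab. apply (ex_RInt_continuous (V := R_CompleteNormedModule)). intros z Hz.
    rewrite Rmin_left in Hz by lra. apply Hc; lra. }
  assert (Hpos : forall a b, 0 < a -> a <= b -> 0 <= RInt f a b).
  { intros a b Ha Hab. apply RInt_ge_0; [trivial|apply Hi; trivial|].
    intros; apply Hp; lra. }
  destruct (completeness (fun y => exists a b, 0 < a /\ a <= b /\ y = RInt f a b))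
    as [l [Hub Hlub]].
  { exists M. intros y (a & b & Ha & Hab & ->). apply HM; trivial. }
  { exists (RInt f 1 1), 1, 1. repeat split; lra. }
  exists l. intros P [eps HP].
  assert (Hex : exists a b, 0 < a /\ a <= b /\ l - eps < RInt f a b).
  { apply Classical_Prop.NNPP. intro N.
    assert (l <= l - eps); [|pose proof (cond_pos eps); lra].
    apply Hlub. intros y (a & b & Ha & Hab & ->).
    apply Rnot_lt_le. intro Hlt. apply N. exists a, b. auto. }
  destruct Hex as (a0 & b0 & Ha0 & Hab0 & Hl).
  apply (Filter_prod _ _ _ (fun a => 0 < a < a0) (fun b => b0 < b)).
  - exists (mkposreal a0 Ha0). intros y Hy Hy0.
    apply ball_R in Hy; simpl in Hy. lra.
  - exists b0. auto.
  - intros a b [Ha1 Ha2] Hb. exists (RInt f a b). simpl. split.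
    + apply (RInt_correct (V := R_CompleteNormedModule)), Hi; lra.
    + apply HP. change (Rabs (RInt f a b - l) < eps).
      assert (RInt f a b <= l) by (apply Hub; exists a, b; repeat split; lra).
      assert (E : RInt f a b = RInt f a a0 + (RInt f a0 b0 + RInt f b0 b)).
      { rewrite <- (RInt_Chasles f a a0 b) by (apply Hi; lra).
        rewrite <- (RInt_Chasles f a0 b0 b) by (apply Hi; lra). reflexivity. }
      pose proof (Hpos a a0 ltac:(lra) ltac:(lra)).
      pose proof (Hpos b0 b ltac:(lra) ltac:(lra)).
      apply Rabs_def1; lra.
Qed.

Definition Gamma_integrand (x t : R) : R := Rpower t (x - 1) * exp (- t).

Lemma Gamma_integrand_continuous (x t : R) : 0 < t -> continuous (Gamma_integrand x) t.
Proof.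
  intro Ht. unfold Gamma_integrand, Rpower.
  apply (ex_derive_continuous (fun t => exp ((x - 1) * ln t) * exp (- t))).
  auto_derive. exact Ht.
Qed.

Lemma Gamma_integrand_pos (x t : R) : 0 < Gamma_integrand x t.
Proof. apply Rmult_lt_0_compat; apply exp_pos. Qed.

(* The majorant is the derivative of the bounded function [(t / (1 + t))^x / x]. *)
Lemma is_RInt_gen_Gamma (x : R) : 0 < x ->
  is_RInt_gen (Gamma_integrand x) (at_right 0) (Rbar_locally p_infty) (Gamma x).
Proof.
  intro Hx.
  assert (H : exists l, is_RInt_gen (Gamma_integrand x)
                          (at_right 0) (Rbar_locally p_infty) l).
  2: { apply (RInt_gen_correct (V := R_CompleteNormedModule) (Gamma_integrand x)), H. }
  (* [C] is [(1 + x)^(1 + x)]. The function [(1 + t)^(1 + x) * exp (- t)] is largest at [t = x],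
     where it equals [C * exp (- x)]; hence [t^(x - 1) * exp (- t)] is at most
     [C * t^(x - 1) / (1 + t)^(x + 1)], which is [W']. *)
  set (C := exp ((1 + x) * ln (1 + x))).
  set (W := fun t => C / x * exp (x * (ln t - ln (1 + t)))).
  set (W' := fun t => C * exp (x * (ln t - ln (1 + t))) * (/ t - / (1 + t))).
  assert (HC : 0 < C) by apply exp_pos.
  apply (RInt_gen_bounded _ (C / x)).
  - intros t Ht. apply Gamma_integrand_continuous, Ht.
  - intros t _. apply Rlt_le, Gamma_integrand_pos.
  - intros a b Ha Hab.
    assert (HW : is_RInt W' a b (W b - W a)).
    { apply (is_RInt_derive W W'); intros t Ht; rewrite Rmin_left in Ht by lra.
      - unfold W, W'. auto_derive; [lra|]. unfold Rminus. field. lra.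
      - apply (ex_derive_continuous W'). unfold W'. auto_derive. lra. }
    apply Rle_trans with (W b - W a).
    + rewrite <- (is_RInt_unique _ _ _ _ HW). apply RInt_le; trivial.
      * apply (ex_RInt_continuous (V := R_CompleteNormedModule)). intros z Hz.
        rewrite Rmin_left in Hz by lra. apply Gamma_integrand_continuous; lra.
      * eexists; exact HW.
      * intros t Ht. unfold Gamma_integrand, Rpower, W', C.
        replace (/ t - / (1 + t)) with (exp (- ln t - ln (1 + t))).
        2: { unfold Rminus. rewrite exp_plus, !exp_Ropp, !exp_ln by lra. field. lra. }
        rewrite <- !exp_plus.
        assert (Hln : ln ((1 + t) / (1 + x)) <= (1 + t) / (1 + x) - 1)
          by (apply ln_le_minus_1, Rdiv_lt_0_compat; lra).
        rewrite ln_div in Hln by lra.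
        apply (Rmult_le_compat_l (1 + x)) in Hln; [|lra].
        replace ((1 + x) * ((1 + t) / (1 + x) - 1)) with (t - x) in Hln by (field; lra).
        apply exp_le_mono. lra.
    + assert (Hb : exp (x * (ln b - ln (1 + b))) <= 1).
      { apply Rle_trans with (exp 0); [apply exp_le_mono|rewrite exp_0; lra].
        assert (ln b < ln (1 + b)) by (apply ln_increasing; lra).
        nra. }
      assert (0 < W a) by (unfold W; apply Rmult_lt_0_compat;
        [apply Rdiv_lt_0_compat|apply exp_pos]; lra).
      assert (W b <= C / x).
      { unfold W. rewrite <- (Rmult_1_r (C / x)) at 2.
        apply Rmult_le_compat_l; [|exact Hb].
        apply Rlt_le, Rdiv_lt_0_compat; lra. }
      lra.
Qed.

Lemma prod_right_0_p_infty (P : R * R -> Prop) :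
  (forall a b, 0 < a -> a < b -> P (a, b)) ->
  filter_prod (at_right 0) (Rbar_locally p_infty) P.
Proof.
  intro H. apply (Filter_prod _ _ _ (fun a => 0 < a < 1) (fun b => 1 < b)).
  - exists (mkposreal 1 Rlt_0_1). intros y Hy Hy0.
    apply ball_R in Hy; simpl in Hy. lra.
  - exists 1. auto.
  - intros; apply H; lra.
Qed.

(** Covers both boundary terms [t^x * exp (- t)] of the integration by parts, at 0 and at infinity:
    in either case the exponent tends to minus infinity. *)
Lemma Gamma_boundary (x : R) (F : (R -> Prop) -> Prop) {FF : Filter F} :
  (forall M, F (fun t => x * ln t - t < M)) ->
  filterlim (fun t => exp (x * ln t - t)) F (locally 0).
Proof.
  intro H. apply (filterlim_comp _ _ _ (fun t => x * ln t - t) exp F (Rbar_locally m_infty)).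
  - intros P [M HM]. unfold filtermap.
    apply (filter_imp (fun t => x * ln t - t < M)); [|apply H].
    intros t Ht. apply HM, Ht.
  - apply is_lim_exp_m.
Qed.

(** Integration by parts in the form: the derivative of [t^x * exp (- t)] is the difference of the
    two integrands, and it integrates to 0. *)
Lemma Gamma_succ (x : R) : 0 < x -> Gamma (x + 1) = x * Gamma x.
Proof.
  intro Hx.
  assert (Hd : forall t, 0 < t -> is_derive (fun t => exp (x * ln t - t)) t
                 (x * Gamma_integrand x t - Gamma_integrand (x + 1) t)).
  { intros t Ht. auto_derive; [lra|]. unfold Gamma_integrand, Rpower.
    replace (x * ln t + - t) with (x * ln t - t) by ring.
    replace (x + 1 - 1) with x by ring.
    replace (exp ((x - 1) * ln t)) with (exp (x * ln t) * / t).
    - unfold Rminus. rewrite exp_plus. field. lra.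
    - rewrite <- (exp_ln t Ht) at 2. rewrite <- exp_Ropp, <- exp_plus. f_equal. ring. }
  assert (Hg : is_RInt_gen (Derive (fun t => exp (x * ln t - t)))
                 (at_right 0) (Rbar_locally p_infty) (0 - 0)).
  { apply (is_RInt_gen_Derive (fun t => exp (x * ln t - t))).
    - apply prod_right_0_p_infty. intros a b Ha Hab t Ht. simpl in Ht.
      rewrite Rmin_left in Ht by lra. eexists. apply Hd. lra.
    - apply prod_right_0_p_infty. intros a b Ha Hab t Ht. simpl in Ht.
      rewrite Rmin_left in Ht by lra.
      apply (continuous_ext_loc _
               (fun t => x * Gamma_integrand x t - Gamma_integrand (x + 1) t)).
      + exists (mkposreal t ltac:(lra)). intros u Hu.
        apply ball_R in Hu; simpl in Hu. symmetry. apply is_derive_unique, Hd. lra.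
      + apply (continuous_minus (V := R_NormedModule)).
        * apply (continuous_scal_r (V := R_NormedModule) x), Gamma_integrand_continuous; lra.
        * apply Gamma_integrand_continuous; lra.
    - apply Gamma_boundary; [apply _|]. intro M.
      exists (mkposreal _ (exp_pos (M / x))). intros y Hy Hy0.
      unfold ball in Hy; simpl in Hy; unfold AbsRing_ball in Hy; simpl in Hy.
      unfold abs, minus, plus, opp in Hy; simpl in Hy.
      apply Rabs_def2 in Hy.
      assert (L : ln y < M / x) by (rewrite <- (ln_exp (M / x)); apply ln_increasing; lra).
      apply (Rmult_lt_compat_l x) in L; [|exact Hx].
      replace (x * (M / x)) with M in L by (field; lra). lra.
    - apply Gamma_boundary; [apply _|]. intro M.
      (* From [ln (t / (2 * x)) <= t / (2 * x) - 1] the exponent is at most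
         [x * ln (2 * x) - x - t / 2], which drops below [M] beyond this point. *)
      exists (Rmax 0 (2 * (x * ln (2 * x) - x - M))). intros t Ht.
      assert (Ht0 : 0 < t) by (eapply Rle_lt_trans; [apply Rmax_l|exact Ht]).
      assert (HtM : 2 * (x * ln (2 * x) - x - M) < t)
        by (eapply Rle_lt_trans; [apply Rmax_r|exact Ht]).
      assert (L : ln (t / (2 * x)) <= t / (2 * x) - 1)
        by (apply ln_le_minus_1, Rdiv_lt_0_compat; lra).
      rewrite ln_div in L by lra.
      apply (Rmult_le_compat_l x) in L; [|lra].
      replace (x * (t / (2 * x) - 1)) with (t / 2 - x) in L by (field; lra). lra. }
  apply (is_RInt_gen_ext _
           (fun t => minus (scal x (Gamma_integrand x t)) (Gamma_integrand (x + 1) t)))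
    in Hg.
  2: { apply prod_right_0_p_infty. intros a b Ha Hab t Ht. simpl in Ht.
       rewrite Rmin_left in Ht by lra. apply is_derive_unique, Hd; lra. }
  assert (Hg' := is_RInt_gen_minus (V := R_NormedModule) _ _ _ _
     (is_RInt_gen_scal (V := R_NormedModule)
        (Fa := at_right 0) (Fb := Rbar_locally p_infty) _ x _ (is_RInt_gen_Gamma x Hx))
     (is_RInt_gen_Gamma (x + 1) ltac:(lra))).
  apply (is_RInt_gen_unique (V := R_CompleteNormedModule)) in Hg.
  apply (is_RInt_gen_unique (V := R_CompleteNormedModule)) in Hg'.
  assert (E := eq_trans (eq_sym Hg) Hg'). unfold minus, plus, opp, scal in E; simpl in E.
  unfold mult in E; simpl in E. lra.
Qed.

Lemma Gamma_1 : Gamma 1 = 1.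
Proof.
  assert (H : is_RInt_gen (Derive (fun t => - exp (- t)))
                 (at_right 0) (Rbar_locally p_infty) (0 - -1)).
  { apply (is_RInt_gen_Derive (fun t => - exp (- t))).
    - apply prod_right_0_p_infty. intros a b _ _ t _. auto_derive. exact I.
    - apply prod_right_0_p_infty. intros a b _ _ t _.
      apply (continuous_ext (fun t => exp (- t))).
      + intro u. symmetry. apply is_derive_unique. auto_derive; [exact I|ring].
      + apply (ex_derive_continuous (fun t => exp (- t))). auto_derive. exact I.
    - intros P HP.
      assert (HC : continuous (fun t => - exp (- t)) 0).
      { apply (ex_derive_continuous (fun t => - exp (- t))). auto_derive. exact I. }
      unfold continuous in HC. rewrite Ropp_0, exp_0 in HC.
      destruct (HC P HP) as [e He]. exists e. intros y Hy _. exact (He y Hy).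
    - replace 0 with (- 0) by ring.
      apply (is_lim_opp (fun t => exp (- t)) p_infty 0).
      apply (is_lim_comp exp (fun t => - t) p_infty 0 m_infty).
      + apply is_lim_exp_m.
      + apply (is_lim_opp (fun t => t) p_infty p_infty), is_lim_id.
      + exists 0. intros y _ E. discriminate. }
  apply (is_RInt_gen_ext _ (Gamma_integrand 1)) in H.
  2: { apply prod_right_0_p_infty. intros a b Ha Hab t Ht. simpl in Ht.
       rewrite Rmin_left in Ht by lra. unfold Gamma_integrand.
       rewrite Rminus_diag, Rpower_O by lra.
       apply is_derive_unique. auto_derive; [exact I|ring]. }
  apply (is_RInt_gen_unique (V := R_CompleteNormedModule)) in H.
  unfold Gamma. fold (Gamma_integrand 1).
  transitivity (0 - -1); [exact H|ring].
Qed.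

(* Integrate Bernoulli's inequality [(t/s)^h <= 1 - h + h t/s]. *)
Lemma Gamma_add_le (s h : R) : 0 < s -> 0 <= h <= 1 ->
  0 <= Gamma (s + h) <= exp (h * ln s) * Gamma s.
Proof.
  intros Hs Hh.
  set (f := Gamma_integrand (s + h)).
  set (g := fun t => plus (scal (exp (h * ln s) * (1 - h)) (Gamma_integrand s t))
                          (scal (exp (h * ln s) * (h / s)) (Gamma_integrand (s + 1) t))).
  assert (Hf := is_RInt_gen_Gamma (s + h) ltac:(lra)).
  assert (Hg := is_RInt_gen_plus (V := R_NormedModule)
     (Fa := at_right 0) (Fb := Rbar_locally p_infty) _ _ _ _
     (is_RInt_gen_scal (V := R_NormedModule)
        (Fa := at_right 0) (Fb := Rbar_locally p_infty) _ (exp (h * ln s) * (1 - h)) _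
        (is_RInt_gen_Gamma s Hs))
     (is_RInt_gen_scal (V := R_NormedModule)
        (Fa := at_right 0) (Fb := Rbar_locally p_infty) _ (exp (h * ln s) * (h / s)) _
        (is_RInt_gen_Gamma (s + 1) ltac:(lra)))).
  fold f in Hf. fold g in Hg.
  assert (Hfg : forall t, 0 < t -> 0 <= f t <= g t).
  { intros t Ht. split; [apply Rlt_le, Gamma_integrand_pos|].
    unfold f, g, plus, scal; simpl; unfold mult; simpl.
    unfold Gamma_integrand, Rpower.
    replace ((s + h - 1) * ln t) with ((s - 1) * ln t + h * ln s + h * (ln t - ln s)) by ring.
    replace ((s + 1 - 1) * ln t) with ((s - 1) * ln t + ln t) by ring.
    rewrite !exp_plus, (exp_ln t Ht).
    assert (B : exp (h * (ln t - ln s)) <= 1 - h + h * (t / s)).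
    { assert (Hc : 0 < 1 - h + h * (t / s)).
      { assert (0 < t / s) by (apply Rdiv_lt_0_compat; lra).
        destruct (Req_dec h 0) as [-> |Hh0]; [lra|].
        assert (0 < h * (t / s)) by (apply Rmult_lt_0_compat; lra). lra. }
      rewrite <- (exp_ln _ Hc). apply exp_le_mono.
      rewrite <- ln_div by lra.
      assert (Ht' : 0 < t / s) by (apply Rdiv_lt_0_compat; lra).
      set (u := t / s) in *. set (w := 1 - h + h * u) in *.
      (* Concavity of [ln] through its tangent at [w]: weighted by [h] and [1 - h], the inequalities
         [L1] and [L2] add up to [h * ln u - ln w <= 0]. *)
      assert (L1 : ln (u / w) <= u / w - 1)
        by (apply ln_le_minus_1, Rdiv_lt_0_compat; lra).
      assert (L2 : ln (1 / w) <= 1 / w - 1)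
        by (apply ln_le_minus_1, Rdiv_lt_0_compat; lra).
      rewrite ln_div in L1 by lra. rewrite ln_div, ln_1 in L2 by lra.
      assert (E : h * (u / w - 1) + (1 - h) * (1 / w - 1) = 0)
        by (unfold w in *; field; lra).
      nra. }
    set (A := exp ((s - 1) * ln t)). set (D := exp (h * ln s)). set (E := exp (- t)).
    assert (0 < A * D * E) by (repeat apply Rmult_lt_0_compat; apply exp_pos).
    apply (Rmult_le_compat_l (A * D * E)) in B; [|lra].
    replace (D * (1 - h) * (A * E) + D * (h / s) * (A * t * E))
      with (A * D * E * (1 - h + h * (t / s))) by (field; lra).
    lra. }
  assert (Hle : forall (u v : R -> R) (lu lv : R), (forall t, 0 < t -> 0 <= u t <= v t) ->
    is_RInt_gen u (at_right 0) (Rbar_locally p_infty) lu ->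
    is_RInt_gen v (at_right 0) (Rbar_locally p_infty) lv -> Rabs lu <= lv).
  { intros u v lu lv Huv Hu Hv.
    apply (RInt_gen_norm (V := R_CompleteNormedModule)
             (Fa := at_right 0) (Fb := Rbar_locally p_infty) u v lu lv); trivial.
    - apply prod_right_0_p_infty. intros a b Ha Hab. simpl. lra.
    - apply prod_right_0_p_infty. intros a b Ha Hab t Ht. simpl in Ht.
      unfold norm; simpl; unfold abs; simpl.
      rewrite Rabs_pos_eq; apply Huv; lra. }
  split.
  (* Comparing [f] with itself bounds the absolute value of the integral by the integral, which
     forces it to be nonnegative. *)
  - assert (H : Rabs (Gamma (s + h)) <= Gamma (s + h)).
    { apply (Hle f f); trivial. intros t Ht. specialize (Hfg t Ht). lra. }
    eapply Rle_trans; [apply Rabs_pos|exact H].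
  - assert (H := Hle f g _ _ Hfg Hf Hg). apply Rle_trans with (1 := Rle_abs _).
    eapply Rle_trans; [exact H|]. rewrite (Gamma_succ s Hs).
    unfold plus, scal; simpl; unfold mult; simpl. apply Req_le. field. lra.
Qed.

(** * The trigamma series *)

Lemma ln_ge_1_minus_inv (u : R) : 0 < u -> 1 - / u <= ln u.
Proof.
  intro Hu. assert (H := ln_le_minus_1 (/ u) (Rinv_0_lt_compat _ Hu)).
  rewrite ln_Rinv in H by exact Hu. lra.
Qed.

Lemma ln_minus_bounds (u v : R) : 0 < u -> 0 < v ->
  (v - u) / v <= ln v - ln u <= (v - u) / u.
Proof.
  intros Hu Hv. rewrite <- ln_div by trivial. split.
  - replace ((v - u) / v) with (1 - / (v / u)) by (field; lra).
    apply ln_ge_1_minus_inv, Rdiv_lt_0_compat; trivial.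
  - replace ((v - u) / u) with (v / u - 1) by (field; lra).
    apply ln_le_minus_1, Rdiv_lt_0_compat; trivial.
Qed.

(** The hypothesis is a family of non-strict inequalities between values of [F], so unlike
    differentiability it survives pointwise limits. *)
Lemma is_derive_of_quadratic (F : R -> R) (x d K : R) (del : posreal) :
  (forall y, Rabs (y - x) < del ->
     Rabs (F y - F x - (y - x) * d) <= K * (y - x) ^ 2) ->
  is_derive F x d.
Proof.
  intro H. apply is_derive_Reals. intros eps Heps.
  assert (HK : 0 < Rabs K + 1) by (pose proof (Rabs_pos K); lra).
  assert (Hd : 0 < Rmin del (eps / (Rabs K + 1)))
    by (apply Rmin_pos; [apply cond_pos|apply Rdiv_lt_0_compat; lra]).
  exists (mkposreal _ Hd). simpl. intros h Hh Hhd.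
  assert (H1 := Rlt_le_trans _ _ _ Hhd (Rmin_l _ _)).
  assert (H2 := Rlt_le_trans _ _ _ Hhd (Rmin_r _ _)).
  specialize (H (x + h)). replace (x + h - x) with h in H by ring.
  specialize (H H1).
  replace ((F (x + h) - F x) / h - d) with ((F (x + h) - F x - h * d) / h)
    by (field; exact Hh).
  unfold Rdiv. rewrite Rabs_mult, Rabs_inv.
  assert (Hp := Rabs_pos_lt _ Hh).
  apply Rmult_lt_reg_r with (Rabs h); [exact Hp|].
  rewrite Rmult_assoc, Rinv_l, Rmult_1_r by lra.
  eapply Rle_lt_trans; [exact H|]. rewrite <- (pow2_abs h).
  apply (Rmult_lt_compat_r (Rabs K + 1)) in H2; [|exact HK].
  unfold Rdiv in H2. rewrite Rmult_assoc, Rinv_l, Rmult_1_r in H2 by lra.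
  pose proof (Rle_abs K). nra.
Qed.

(** The uniform bound on second derivatives takes the place of uniform convergence of first
    derivatives. Two mean value steps give a quadratic error bound with the same [K] for all [n],
    and [n] tends to infinity in it. *)
Lemma is_derive_lim (f f1 f2 : nat -> R -> R) (F : R -> R) (x d K : R) (del : posreal) :
  (forall n y, Rabs (y - x) < del -> is_derive (f n) y (f1 n y)) ->
  (forall n y, Rabs (y - x) < del -> is_derive (f1 n) y (f2 n y)) ->
  (forall n y, Rabs (y - x) < del -> Rabs (f2 n y) <= K) ->
  (forall y, Rabs (y - x) < del -> is_lim_seq (fun n => f n y) (F y)) ->
  is_lim_seq (fun n => f1 n x) d ->
  is_derive F x d.
Proof.
  intros H1 H2 HK HF Hd. apply (is_derive_of_quadratic F x d K del).
  intros y Hy.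
  assert (Hb : forall t, Rmin x y <= t <= Rmax x y -> Rabs (t - x) <= Rabs (y - x)).
  { intro t. unfold Rmin, Rmax. destruct (Rle_dec x y); intro Ht;
      unfold Rabs; destruct (Rcase_abs (t - x)), (Rcase_abs (y - x)); lra. }
  assert (Hn : forall n, Rabs (f n y - f n x - (y - x) * f1 n x) <= K * (y - x) ^ 2).
  { intro n.
    destruct (MVT_gen (f n) x y (f1 n)) as [c [Hc E]].
    { intros t Ht. apply H1. eapply Rle_lt_trans; [apply Hb; lra|exact Hy]. }
    { intros t Ht. apply continuity_pt_filterlim, (ex_derive_continuous (f n)).
      eexists. apply H1. eapply Rle_lt_trans; [apply Hb; lra|exact Hy]. }
    assert (Hcx := Hb c Hc).
    destruct (MVT_gen (f1 n) x c (f2 n)) as [c' [Hc' E']].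
    { intros t Ht. apply H2. eapply Rle_lt_trans; [apply Hb|exact Hy].
      revert Hc Ht. unfold Rmin, Rmax.
      destruct (Rle_dec x y), (Rle_dec x c); lra. }
    { intros t Ht. apply continuity_pt_filterlim, (ex_derive_continuous (f1 n)).
      eexists. apply H2. eapply Rle_lt_trans; [apply Hb|exact Hy].
      revert Hc Ht. unfold Rmin, Rmax.
      destruct (Rle_dec x y), (Rle_dec x c); lra. }
    assert (Hk : Rabs (f2 n c') <= K).
    { apply HK. eapply Rle_lt_trans; [apply Hb|exact Hy].
      revert Hc Hc'. unfold Rmin, Rmax.
      destruct (Rle_dec x y), (Rle_dec x c); lra. }
    replace (f n y - f n x - (y - x) * f1 n x)
      with (f2 n c' * (c - x) * (y - x)) by (rewrite E, <- E'; ring).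
    rewrite !Rabs_mult, <- (pow2_abs (y - x)).
    pose proof (Rabs_pos (c - x)). pose proof (Rabs_pos (y - x)).
    pose proof (Rabs_pos (f2 n c')).
    replace (K * Rabs (y - x) ^ 2) with (K * Rabs (y - x) * Rabs (y - x)) by ring.
    apply Rmult_le_compat_r; [trivial|]. apply Rmult_le_compat; trivial. }
  assert (Hl : is_lim_seq (fun n => Rabs (f n y - f n x - (y - x) * f1 n x))
                 (Rabs (F y - F x - (y - x) * d))).
  { apply (is_lim_seq_abs _ (F y - F x - (y - x) * d)).
    apply is_lim_seq_minus'; [apply is_lim_seq_minus'|].
    - apply HF, Hy.
    - apply HF. rewrite Rminus_diag, Rabs_R0. apply cond_pos.
    - apply (is_lim_seq_scal_l _ (y - x) d Hd). }
  apply (is_lim_seq_le _ _ _ _ Hn Hl (is_lim_seq_const _)).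
Qed.

(** Moving from [x] up to 1 with [Gamma_add_le] gives [1 <= x^(1 - x) * Gamma x]. *)
Lemma Gamma_pos (x : R) : 0 < x < 1 -> 0 < Gamma x.
Proof.
  intro Hx. assert (H := Gamma_add_le x (1 - x) ltac:(lra) ltac:(lra)).
  replace (x + (1 - x)) with 1 in H by ring. rewrite Gamma_1 in H.
  pose proof (exp_pos ((1 - x) * ln x)). nra.
Qed.

Lemma Gamma_add_nat (x : R) (n : nat) : 0 < x ->
  Gamma (x + INR n) = exp (sum_lt (fun k => ln (x + INR k)) n) * Gamma x.
Proof.
  intro Hx. induction n as [|n IH].
  - unfold sum_lt; simpl. rewrite exp_0, Rplus_0_r. ring.
  - pose proof (pos_INR n).
    rewrite S_INR, <- Rplus_assoc, Gamma_succ, IH, sum_lt_S, exp_plus, exp_ln by lra. ring.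
Qed.

(* Gauss's product [n^x (n-1)! / (x (x+1) ... (x+n-1))], with [n = p + 1]. *)
Definition ln_gauss (p : nat) (x : R) : R :=
  x * ln (INR p + 1) + sum_lt (fun k => ln (1 + INR k)) p
  - sum_lt (fun k => ln (x + INR k)) (S p).

(** The Bohr-Mollerup squeeze: [Gamma_add_le] is used from [p + 1] by [x], then from [p + 1 + x] by
    [1 - x], which lands on [p + 2]. The logarithms of the two bounds differ by
    [(1 - x) * ln ((p + 1 + x) / (p + 1))]. *)
Lemma is_lim_ln_gauss (x : R) : 0 < x < 1 ->
  is_lim_seq (fun p => ln_gauss p x) (ln (Gamma x)).
Proof.
  intro Hx. apply (is_lim_seq_bound _ (fun n => / (INR n + 1))); [|apply is_lim_seq_inv_INR].
  intro p. pose proof (pos_INR p) as Hp. pose proof (Gamma_pos x Hx) as HG.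
  set (A := sum_lt (fun k => ln (1 + INR k)) p).
  set (B := sum_lt (fun k => ln (x + INR k)) (S p)).
  assert (HA : Gamma (INR p + 1) = exp A).
  { rewrite Rplus_comm, Gamma_add_nat, Gamma_1 by lra. apply Rmult_1_r. }
  assert (HB : Gamma (INR p + 1 + x) = exp B * Gamma x).
  { rewrite <- S_INR, Rplus_comm. apply Gamma_add_nat. lra. }
  assert (HGB : 0 < exp B * Gamma x) by (apply Rmult_lt_0_compat; [apply exp_pos|exact HG]).
  assert (H1 := Gamma_add_le (INR p + 1) x ltac:(lra) ltac:(lra)).
  assert (H2 := Gamma_add_le (INR p + 1 + x) (1 - x) ltac:(lra) ltac:(lra)).
  replace (INR p + 1 + x + (1 - x)) with (INR p + 1 + 1) in H2 by ring.
  rewrite Gamma_succ, HB, HA in H2 by lra. rewrite HB, HA in H1.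
  assert (HH : forall a b, 0 < a -> a <= b -> ln a <= ln b).
  { intros a b Ha [Hab| ->]; [apply Rlt_le, ln_increasing; trivial|apply Rle_refl]. }
  apply proj2, HH in H1; [|exact HGB].
  apply proj2, HH in H2; [|apply Rmult_lt_0_compat; [lra|apply exp_pos]].
  rewrite !ln_mult, !ln_exp in H1 by (trivial; apply exp_pos).
  rewrite !ln_mult, !ln_exp in H2 by (trivial; first [lra|apply exp_pos]).
  assert (H3 := ln_minus_bounds (INR p + 1) (INR p + 1 + x) ltac:(lra) ltac:(lra)).
  replace ((INR p + 1 + x - (INR p + 1)) / (INR p + 1)) with (x * / (INR p + 1)) in H3
    by (field; lra).
  assert (H4 : 0 < / (INR p + 1)) by (apply Rinv_0_lt_compat; lra).
  assert (H5 : (1 - x) * (ln (INR p + 1 + x) - ln (INR p + 1)) <= / (INR p + 1)).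
  { assert (x * / (INR p + 1) <= 1 * / (INR p + 1)) by (apply Rmult_le_compat_r; lra).
    assert (0 <= ln (INR p + 1 + x) - ln (INR p + 1))
      by (apply Rle_trans with (2 := proj1 H3); apply Rlt_le, Rdiv_lt_0_compat; lra).
    nra. }
  unfold ln_gauss. fold A B. apply Rabs_le. lra.
Qed.

Definition ln_gauss' (p : nat) (x : R) : R :=
  ln (INR p + 1) - sum_lt (fun k => / (x + INR k)) (S p).

Lemma is_derive_ln_gauss (p : nat) (x : R) : 0 < x ->
  is_derive (ln_gauss p) x (ln_gauss' p x).
Proof.
  intro Hx. unfold ln_gauss, ln_gauss'.
  apply (is_derive_minus (K := R_AbsRing) (V := R_NormedModule)
           (fun x => x * ln (INR p + 1) + sum_lt (fun k => ln (1 + INR k)) p)).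
  - auto_derive; [exact I|ring].
  - apply (is_derive_sum_lt (fun k x => ln (x + INR k)) (fun k x => / (x + INR k))).
    intros k _. pose proof (pos_INR k). auto_derive; [lra|field; lra].
Qed.

Lemma is_derive_ln_gauss' (p : nat) (x : R) : 0 < x ->
  is_derive (ln_gauss' p) x (sum_lt (fun k => / (x + INR k) ^ 2) (S p)).
Proof.
  intro Hx. unfold ln_gauss'.
  replace (sum_lt (fun k => / (x + INR k) ^ 2) (S p))
    with (0 - sum_lt (fun k => -1 * / (x + INR k) ^ 2) (S p))
    by (rewrite sum_lt_scal; ring).
  apply (is_derive_minus (K := R_AbsRing) (V := R_NormedModule) (fun x => ln (INR p + 1))).
  - apply (is_derive_const (K := R_AbsRing) (V := R_NormedModule)).
  - apply (is_derive_sum_lt (fun k x => / (x + INR k)) (fun k x => -1 * / (x + INR k) ^ 2)).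
    intros k _. pose proof (pos_INR k). auto_derive; [lra|field; lra].
Qed.

(** Telescoping, since [1 / (t + 1)^2 <= 1 / t - 1 / (t + 1)], with the first term kept apart. A
    bound free of [n] is what [is_derive_lim] requires. *)
Lemma sum_inv_sq_le (c : R) (n : nat) : 0 < c ->
  sum_lt (fun k => / (c + INR k) ^ 2) n <= / c ^ 2 + / c.
Proof.
  intro Hc.
  assert (Hc2 : 0 < / c ^ 2) by (apply Rinv_0_lt_compat, pow_lt, Hc).
  assert (Hc1 : 0 < / c) by (apply Rinv_0_lt_compat, Hc).
  assert (H : forall n, sum_lt (fun k => / (c + INR k) ^ 2) (S n)
                        <= / c ^ 2 + / c - / (c + INR n)).
  { clear n. induction n as [|n IH].
    - rewrite sum_lt_S. unfold sum_lt; simpl. rewrite Rplus_0_r. lra.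
    - rewrite sum_lt_S. eapply Rle_trans; [apply Rplus_le_compat_r, IH|].
      pose proof (pos_INR n). rewrite S_INR. set (t := c + INR n) in *.
      replace (c + (INR n + 1)) with (t + 1) by (unfold t; ring).
      assert (E : / t - / (t + 1) - / (t + 1) ^ 2 = / (t * (t + 1) ^ 2))
        by (field; unfold t; lra).
      assert (0 < / (t * (t + 1) ^ 2)); [|lra].
      apply Rinv_0_lt_compat, Rmult_lt_0_compat; [unfold t; lra|apply pow_lt; unfold t; lra]. }
  destruct n as [|n].
  - unfold sum_lt; simpl. simpl in Hc2. lra.
  - eapply Rle_trans; [apply H|].
    assert (0 < / (c + INR n)); [|lra].
    apply Rinv_0_lt_compat. pose proof (pos_INR n). lra.
Qed.

(** [is_derive_lim] takes the limit of the derivatives at [x] as a hypothesis, so its existence has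
    to come first, by monotonicity. *)
Lemma ex_lim_ln_gauss' (x : R) : 0 < x ->
  exists d : R, is_lim_seq (fun p => ln_gauss' p x) d.
Proof.
  intro Hx.
  (* Shifting the logarithm by [x] makes the sequence decreasing, because the next term
     [1 / (x + p + 1)] dominates the increment of the logarithm; the shift itself tends to 0. *)
  set (E := fun p => ln (INR p + 1 + x) - sum_lt (fun k => / (x + INR k)) (S p)).
  assert (HE : ex_finite_lim_seq E).
  { apply (ex_finite_lim_seq_decr _ (ln x - / x)).
    - intro p. pose proof (pos_INR p). unfold E. rewrite S_INR, (sum_lt_S _ (S p)), S_INR.
      assert (L := ln_minus_bounds (INR p + 1 + x) (INR p + 1 + 1 + x) ltac:(lra) ltac:(lra)).
      replace ((INR p + 1 + 1 + x - (INR p + 1 + x)) / (INR p + 1 + x))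
        with (/ (x + (INR p + 1))) in L by (field; lra). lra.
    - intro p. pose proof (pos_INR p) as Hp. unfold E.
      apply Rle_trans with (ln (INR p + x) - sum_lt (fun k => / (x + INR k)) (S p)).
      + clear Hp. induction p as [|p IH].
        * rewrite sum_lt_S. unfold sum_lt; simpl. rewrite Rplus_0_l, Rplus_0_r. lra.
        * pose proof (pos_INR p). rewrite (sum_lt_S _ (S p)), S_INR.
          assert (L := ln_minus_bounds (INR p + x) (INR p + 1 + x) ltac:(lra) ltac:(lra)).
          replace ((INR p + 1 + x - (INR p + x)) / (INR p + 1 + x))
            with (/ (x + (INR p + 1))) in L by (field; lra). lra.
      + assert (ln (INR p + x) < ln (INR p + 1 + x)) by (apply ln_increasing; lra). lra. }
  destruct HE as [d Hd]. exists d.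
  apply (is_lim_seq_ext (fun p => E p - (ln (INR p + 1 + x) - ln (INR p + 1)))).
  { intro p. unfold E, ln_gauss'. ring. }
  replace (Finite d) with (Finite (d - 0)) by (f_equal; ring).
  apply is_lim_seq_minus'; [exact Hd|].
  apply (is_lim_seq_bound _ (fun p => x * / (INR p + 1))).
  - intro p. pose proof (pos_INR p).
    assert (L := ln_minus_bounds (INR p + 1) (INR p + 1 + x) ltac:(lra) ltac:(lra)).
    replace ((INR p + 1 + x - (INR p + 1)) / (INR p + 1)) with (x * / (INR p + 1)) in L
      by (field; lra).
    assert (0 < (INR p + 1 + x - (INR p + 1)) / (INR p + 1 + x))
      by (apply Rdiv_lt_0_compat; lra).
    apply Rabs_le. lra.
  - replace (Finite 0) with (Rbar_mult x 0) by (simpl; f_equal; ring).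
    apply is_lim_seq_scal_l, is_lim_seq_inv_INR.
Qed.

(** This radius keeps [y] below 1, where [is_lim_ln_gauss] applies, and above [x / 2], away from the
    pole at 0, so that bounds computed at [x / 2] are uniform. *)
Lemma ball_half (x y : R) (Hx : 0 < x < 1) :
  Rabs (y - x) < Rmin (x / 2) (1 - x) ->
  x / 2 < y < 1.
Proof.
  intro H. apply Rabs_def2 in H.
  pose proof (Rmin_l (x / 2) (1 - x)). pose proof (Rmin_r (x / 2) (1 - x)). lra.
Qed.

Lemma sum_inv_sq_abs_le (c y : R) (n : nat) : 0 < c < y ->
  Rabs (sum_lt (fun k => / (y + INR k) ^ 2) n) <= / c ^ 2 + / c.
Proof.
  intro Hc. rewrite Rabs_pos_eq.
  - eapply Rle_trans; [|apply (sum_inv_sq_le c n); lra].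
    apply sum_lt_le. intros k _. pose proof (pos_INR k).
    apply Rinv_le_contravar; [apply pow_lt; lra|apply pow_incr; lra].
  - apply Rle_trans with (sum_lt (fun _ => 0) n).
    + rewrite sum_lt_const. lra.
    + apply sum_lt_le. intros k _. pose proof (pos_INR k).
      apply Rlt_le, Rinv_0_lt_compat, pow_lt. lra.
Qed.

(** [is_derive_lim] differentiates [ln (Gamma y)]; composing with [exp] gives a genuine derivative
    of [Gamma], so that the quotient in [digamma] is the logarithmic derivative. *)
Lemma is_lim_digamma (x : R) : 0 < x < 1 ->
  is_lim_seq (fun p => ln_gauss' p x) (digamma x).
Proof.
  intro Hx. destruct (ex_lim_ln_gauss' x (proj1 Hx)) as [d Hd].
  enough (E : digamma x = d) by (rewrite E; exact Hd).
  assert (HL : is_derive (fun y => ln (Gamma y)) x d).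
  { apply (is_derive_lim ln_gauss ln_gauss'
             (fun p y => sum_lt (fun k => / (y + INR k) ^ 2) (S p)) _ x d
             (/ (x / 2) ^ 2 + / (x / 2))
             (mkposreal (Rmin (x / 2) (1 - x)) ltac:(apply Rmin_pos; lra))).
    - intros n y Hy. apply (ball_half x y Hx) in Hy. apply is_derive_ln_gauss. lra.
    - intros n y Hy. apply (ball_half x y Hx) in Hy. apply is_derive_ln_gauss'. lra.
    - intros n y Hy. apply (ball_half x y Hx) in Hy. apply sum_inv_sq_abs_le. lra.
    - intros y Hy. apply (ball_half x y Hx) in Hy. apply is_lim_ln_gauss. lra.
    - exact Hd. }
  assert (HG : is_derive Gamma x (d * Gamma x)).
  { apply (is_derive_ext_loc (fun y => exp (ln (Gamma y)))).
    - exists (mkposreal (Rmin (x / 2) (1 - x)) ltac:(apply Rmin_pos; lra)).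
      intros y Hy. apply (ball_half x y Hx) in Hy. apply exp_ln, Gamma_pos. lra.
    - rewrite <- (exp_ln (Gamma x)) at 1 by (apply Gamma_pos, Hx).
      apply (is_derive_comp exp (fun y => ln (Gamma y))); [|exact HL].
      apply is_derive_exp. }
  unfold digamma. rewrite (is_derive_unique _ _ _ HG). field.
  apply Rgt_not_eq, Gamma_pos, Hx.
Qed.

(** The same argument one derivative higher. The sum of cubes is bounded uniformly by splitting off
    one factor [1 / (y + k) <= 1 / c], which leaves the sum of squares. *)
Lemma is_lim_trigamma (x : R) : 0 < x < 1 ->
  is_lim_seq (sum_lt (fun k => / (x + INR k) ^ 2)) (trigamma x).
Proof.
  intro Hx.
  assert (HE : ex_finite_lim_seq (sum_lt (fun k => / (x + INR k) ^ 2))).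
  { apply (ex_finite_lim_seq_incr _ (/ x ^ 2 + / x)).
    - intro n. rewrite sum_lt_S. pose proof (pos_INR n).
      assert (0 < / (x + INR n) ^ 2) by (apply Rinv_0_lt_compat, pow_lt; lra). lra.
    - intro n. apply sum_inv_sq_le. lra. }
  destruct HE as [d Hd].
  enough (E : trigamma x = d) by (rewrite E; exact Hd).
  apply is_derive_unique.
  set (c := x / 2). assert (Hc : 0 < c) by (unfold c; lra).
  apply (is_derive_lim ln_gauss' (fun p y => sum_lt (fun k => / (y + INR k) ^ 2) (S p))
             (fun p y => sum_lt (fun k => -2 * / (y + INR k) ^ 3) (S p)) _ x d
             (2 / c * (/ c ^ 2 + / c))
             (mkposreal (Rmin (x / 2) (1 - x)) ltac:(apply Rmin_pos; lra))).
  - intros n y Hy. apply (ball_half x y Hx) in Hy. apply is_derive_ln_gauss'. lra.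
  - intros n y Hy. apply (ball_half x y Hx) in Hy.
    apply (is_derive_sum_lt (fun k x => / (x + INR k) ^ 2)
             (fun k x => -2 * / (x + INR k) ^ 3)).
    intros k _. pose proof (pos_INR k).
    auto_derive; [apply Rgt_not_eq; apply (pow_lt _ 2); lra|field; lra].
  - intros n y Hy. apply (ball_half x y Hx) in Hy. fold c in Hy.
    rewrite sum_lt_scal, Rabs_mult. rewrite (Rabs_left (-2)) by lra.
    rewrite Rabs_pos_eq.
    2: { apply Rle_trans with (sum_lt (fun _ => 0) (S n)).
         - rewrite sum_lt_const. lra.
         - apply sum_lt_le. intros k _. pose proof (pos_INR k).
           apply Rlt_le, Rinv_0_lt_compat, pow_lt. lra. }
    replace (2 / c * (/ c ^ 2 + / c)) with (- -2 * (/ c * (/ c ^ 2 + / c))) by (field; lra).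
    apply Rmult_le_compat_l; [lra|].
    apply Rle_trans with (/ c * sum_lt (fun k => / (c + INR k) ^ 2) (S n)).
    + rewrite <- sum_lt_scal. apply sum_lt_le. intros k _. pose proof (pos_INR k).
      replace ((y + INR k) ^ 3) with ((y + INR k) * (y + INR k) ^ 2) by ring.
      rewrite Rinv_mult. apply Rmult_le_compat.
      * apply Rlt_le, Rinv_0_lt_compat; lra.
      * apply Rlt_le, Rinv_0_lt_compat, pow_lt; lra.
      * apply Rinv_le_contravar; lra.
      * apply Rinv_le_contravar; [apply pow_lt; lra|apply pow_incr; lra].
    + apply Rmult_le_compat_l; [apply Rlt_le, Rinv_0_lt_compat; lra|].
      apply sum_inv_sq_le, Hc.
  - intros y Hy. apply (ball_half x y Hx) in Hy. apply is_lim_digamma. lra.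
  - apply (is_lim_seq_incr_1 (sum_lt (fun k => / (x + INR k) ^ 2))), Hd.
Qed.

(** * The reflection formula for trigamma *)

Lemma inv_sin_sq_half (s : R) : 0 < s < PI ->
  / sin s ^ 2 = (/ sin (s / 2) ^ 2 + / sin ((PI - s) / 2) ^ 2) / 4.
Proof.
  intro Hs.
  replace ((PI - s) / 2) with (PI / 2 - s / 2) by field.
  rewrite sin_shift.
  assert (H1 : 0 < sin (s / 2)) by (apply sin_gt_0; lra).
  assert (H2 : 0 < cos (s / 2)) by (apply cos_gt_0; lra).
  replace (sin s) with (2 * sin (s / 2) * cos (s / 2))
    by (rewrite <- sin_2a; f_equal; field).
  assert (E := sin2_cos2 (s / 2)). unfold Rsqr in E.
  replace (/ sin (s / 2) ^ 2 + / cos (s / 2) ^ 2)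
    with ((sin (s / 2) * sin (s / 2) + cos (s / 2) * cos (s / 2))
          / (sin (s / 2) * cos (s / 2)) ^ 2) by (field; lra).
  rewrite E. field. lra.
Qed.

(* By doubling: [1/sin^2 s] is a quarter of the sum of its values at [s/2] and [(pi - s)/2]. *)
Lemma sum_inv_sin_sq (x : R) (n : nat) : 0 < x < 1 ->
  sum_lt (fun k => / sin (PI * (x + INR k) / (2 * 2 ^ n)) ^ 2
                   + / sin (PI * (INR k + 1 - x) / (2 * 2 ^ n)) ^ 2) (2 ^ n)
  = 4 * (2 ^ n) ^ 2 / sin (PI * x) ^ 2.
Proof.
  intro Hx. pose proof PI_RGT_0 as HPI.
  assert (Hs : 0 < sin (PI * x)) by (apply sin_gt_0; nra).
  induction n as [|n IH].
  - simpl Nat.pow. rewrite sum_lt_S. unfold sum_lt; simpl fold_right. simpl INR.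
    replace (4 * (2 ^ 0) ^ 2 / sin (PI * x) ^ 2) with (4 * / sin (PI * x) ^ 2)
      by (simpl; field; lra).
    rewrite (inv_sin_sq_half (PI * x)) by nra.
    replace (PI * (x + 0) / (2 * 2 ^ 0)) with (PI * x / 2) by (simpl; field).
    replace (PI * (0 + 1 - x) / (2 * 2 ^ 0)) with ((PI - PI * x) / 2) by (simpl; field).
    field. split; apply Rgt_not_eq, sin_gt_0; nra.
  - set (M := 2 ^ n) in *.
    assert (HM : 0 < M) by (apply pow_lt; lra).
    assert (HMn : INR (2 ^ n) = M) by (rewrite pow_INR; reflexivity).
    set (r := fun k => / sin (PI * (x + INR k) / (2 * 2 ^ S n)) ^ 2
                   + / sin (PI * (INR k + 1 - x) / (2 * 2 ^ S n)) ^ 2).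
    replace (2 ^ S n)%nat with (2 ^ n + 2 ^ n)%nat by (simpl; lia).
    (* The upper half is reversed because the angles [(PI - s) / 2] coming from index [k] belong to
       index [2^(n + 1) - 1 - k] at the next level, with the two families of angles exchanged. *)
    rewrite sum_lt_add, <- (sum_lt_rev (fun k => r (2 ^ n + k)%nat)), <- sum_lt_plus.
    replace (4 * (2 ^ S n) ^ 2 / sin (PI * x) ^ 2) with (4 * (4 * M ^ 2 / sin (PI * x) ^ 2))
      by (change (2 ^ S n) with (2 * M); field; lra).
    rewrite <- IH, <- sum_lt_scal. apply sum_lt_ext. intros k Hk.
    assert (HkM : INR k + 1 <= M) by (rewrite <- HMn, <- S_INR; apply le_INR; lia).
    pose proof (pos_INR k) as Hk0.
    assert (Ek : INR (2 ^ n + (2 ^ n - 1 - k)) = 2 * M - 1 - INR k).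
    { rewrite plus_INR, !minus_INR by lia. rewrite HMn. simpl. ring. }
    unfold r. rewrite Ek. change (2 ^ S n) with (2 * M).
    assert (Hfrac : forall t, 0 < t < M -> 0 < PI * t / (2 * M) < PI).
    { intros t Ht. split.
      - apply Rdiv_lt_0_compat; nra.
      - apply Rmult_lt_reg_r with (2 * M); [lra|].
        unfold Rdiv. rewrite Rmult_assoc, Rinv_l by lra. nra. }
    rewrite (inv_sin_sq_half (PI * (x + INR k) / (2 * M))) by (apply Hfrac; lra).
    rewrite (inv_sin_sq_half (PI * (INR k + 1 - x) / (2 * M))) by (apply Hfrac; lra).
    replace (PI * (x + INR k) / (2 * M) / 2) with (PI * (x + INR k) / (2 * (2 * M)))
      by (field; lra).
    replace (PI * (INR k + 1 - x) / (2 * M) / 2) with (PI * (INR k + 1 - x) / (2 * (2 * M)))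
      by (field; lra).
    replace ((PI - PI * (x + INR k) / (2 * M)) / 2)
      with (PI * (2 * M - 1 - INR k + 1 - x) / (2 * (2 * M))) by (field; lra).
    replace ((PI - PI * (INR k + 1 - x) / (2 * M)) / 2)
      with (PI * (x + (2 * M - 1 - INR k)) / (2 * (2 * M))) by (field; lra).
    field. repeat split; apply Rgt_not_eq, sin_gt_0; try (apply Rdiv_lt_0_compat; nra);
      (apply Rmult_lt_reg_r with (2 * (2 * M)); [lra|];
       unfold Rdiv; rewrite Rmult_assoc, Rinv_l by lra; nra).
Qed.

(** The lower bound is [sin s < s]. For the upper one, [s * cos s <= sin s] is squared and
    [s^2 * sin s ^ 2] added, giving [s^2 <= sin s ^ 2 * (1 + s^2)]. *)
Lemma inv_sin_sq_bounds (s : R) : 0 < s < PI / 2 ->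
  / s ^ 2 <= / sin s ^ 2 <= / s ^ 2 + 1.
Proof.
  intro Hs.
  assert (H1 : 0 < sin s) by (apply sin_gt_0; lra).
  assert (H2 : 0 < cos s) by (apply cos_gt_0; lra).
  assert (H3 := sin_lt_x s (proj1 Hs)).
  assert (H4 : s * cos s <= sin s).
  { assert (H : sin 0 - 0 * cos 0 <= sin s - s * cos s).
    { apply (derive_nonneg_le (fun t => sin t - t * cos t) (fun t => t * sin t)); [lra| |].
      - intros t Ht. auto_derive; [exact I|ring].
      - intros t Ht. apply Rmult_le_pos; [lra|apply sin_ge_0; lra]. }
    rewrite sin_0 in H. lra. }
  split.
  - apply Rinv_le_contravar; [apply pow_lt; exact H1|apply pow_incr; lra].
  - assert (E := sin2_cos2 s). unfold Rsqr in E.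
    assert (H5 : s ^ 2 <= sin s ^ 2 * (1 + s ^ 2)).
    { assert (0 < s * cos s) by (apply Rmult_lt_0_compat; lra).
      assert ((s * cos s) ^ 2 <= sin s ^ 2) by (apply pow_incr; lra).
      replace (s ^ 2) with (s ^ 2 * (sin s * sin s + cos s * cos s)) at 1
        by (rewrite E; ring).
      replace (s ^ 2 * (sin s * sin s + cos s * cos s))
        with (s ^ 2 * sin s ^ 2 + (s * cos s) ^ 2) by ring.
      lra. }
    replace (/ s ^ 2 + 1) with ((1 + s ^ 2) * / s ^ 2) by (field; lra).
    assert (0 < s ^ 2) by (apply pow_lt; lra).
    assert (0 < sin s ^ 2) by (apply pow_lt; lra).
    apply Rmult_le_reg_r with (s ^ 2 * sin s ^ 2); [apply Rmult_lt_0_compat; trivial|].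
    replace (/ sin s ^ 2 * (s ^ 2 * sin s ^ 2)) with (s ^ 2) by (field; lra).
    replace ((1 + s ^ 2) * / s ^ 2 * (s ^ 2 * sin s ^ 2)) with (sin s ^ 2 * (1 + s ^ 2))
      by (field; lra).
    exact H5.
Qed.

(** Each of the [2 * 2^n] terms of the doubling identity differs from a multiple of an inverse
    square by at most 1, while the identity has size [4^n]. The partial sums are followed along
    powers of two, the lengths that doubling provides. *)
Lemma trigamma_reflection (x : R) : 0 < x < 1 ->
  trigamma x + trigamma (1 - x) = PI ^ 2 / sin (PI * x) ^ 2.
Proof.
  intro Hx. pose proof PI_RGT_0 as HPI.
  set (A := fun M => sum_lt (fun k => / (x + INR k) ^ 2) M
                     + sum_lt (fun k => / (1 - x + INR k) ^ 2) M).
  assert (HA : is_lim_seq A (trigamma x + trigamma (1 - x)))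
    by (apply is_lim_seq_plus'; apply is_lim_trigamma; lra).
  assert (Hpow : forall n, (n < 2 ^ n)%nat) by (intro; apply Nat.pow_gt_lin_r; lia).
  assert (HA2 : is_lim_seq (fun n => A (2 ^ n)%nat) (trigamma x + trigamma (1 - x))).
  { apply (is_lim_seq_subseq A _ (fun n => (2 ^ n)%nat)); [|exact HA].
    intros P [N HN]. exists N. intros n Hn. apply HN. specialize (Hpow n). lia. }
  assert (HB : is_lim_seq (fun n => A (2 ^ n)%nat) (PI ^ 2 / sin (PI * x) ^ 2)).
  { apply (is_lim_seq_bound _ (fun n => PI ^ 2 * / (INR n + 1))).
    2: { replace (Finite 0) with (Rbar_mult (PI ^ 2) 0) by (simpl; f_equal; ring).
         apply is_lim_seq_scal_l, is_lim_seq_inv_INR. }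
    intro n. set (M := 2 ^ n).
    assert (HMn : INR (2 ^ n) = M) by (rewrite pow_INR; reflexivity).
    assert (HnM : INR n + 1 <= M).
    { rewrite <- HMn, <- S_INR. apply le_INR, Hpow. }
    pose proof (pos_INR n) as Hn0.
    (* The factor between [1 / t^2] and the inverse square of the angle [PI * t / (2 * M)]. Dividing
       the total error [2 * M] by it leaves [PI ^ 2 / (2 * M)]. *)
    set (c := 4 * M ^ 2 / PI ^ 2).
    assert (Hc : 0 < c).
    { apply Rdiv_lt_0_compat; [|apply pow_lt; exact HPI].
      assert (0 < M ^ 2) by (apply pow_lt; lra). lra. }
    assert (E : A (2 ^ n)%nat
      = sum_lt (fun k => / (x + INR k) ^ 2 + / (INR k + 1 - x) ^ 2) (2 ^ n)).
    { unfold A. rewrite <- sum_lt_plus. apply sum_lt_ext. intros k _.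
      replace (1 - x + INR k) with (INR k + 1 - x) by ring. reflexivity. }
    assert (S1 := sum_inv_sin_sq x n Hx). fold M in S1.
    assert (Hb : forall t, 0 < t < M ->
      c * / t ^ 2 <= / sin (PI * t / (2 * M)) ^ 2 <= c * / t ^ 2 + 1).
    { intros t Ht.
      replace (c * / t ^ 2) with (/ (PI * t / (2 * M)) ^ 2) by (unfold c; field; lra).
      apply inv_sin_sq_bounds. split.
      - apply Rdiv_lt_0_compat; nra.
      - apply Rmult_lt_reg_r with (2 * M); [lra|].
        unfold Rdiv. rewrite Rmult_assoc, Rinv_l by lra. nra. }
    assert (Hk : forall k, (k < 2 ^ n)%nat -> 0 < x + INR k < M /\ 0 < INR k + 1 - x < M).
    { intros k Hk. pose proof (pos_INR k).
      assert (INR k + 1 <= M) by (rewrite <- HMn, <- S_INR; apply le_INR; lia). lra. }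
    assert (L1 : c * A (2 ^ n)%nat <= 4 * M ^ 2 / sin (PI * x) ^ 2).
    { rewrite <- S1, E, <- sum_lt_scal. apply sum_lt_le. intros k Hkn.
      destruct (Hk k Hkn) as [K1 K2].
      pose proof (Hb _ K1). pose proof (Hb _ K2). lra. }
    assert (L2 : 4 * M ^ 2 / sin (PI * x) ^ 2 <= c * A (2 ^ n)%nat + M * 2).
    { rewrite <- S1, E, <- sum_lt_scal, <- HMn, <- sum_lt_const, <- sum_lt_plus, HMn.
      apply sum_lt_le. intros k Hkn.
      destruct (Hk k Hkn) as [K1 K2].
      pose proof (Hb _ K1). pose proof (Hb _ K2). lra. }
    assert (Hs : 0 < sin (PI * x)) by (apply sin_gt_0; nra).
    replace (4 * M ^ 2 / sin (PI * x) ^ 2) with (c * (PI ^ 2 / sin (PI * x) ^ 2)) in L1, L2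
      by (unfold c; field; lra).
    replace (M * 2) with (c * (PI ^ 2 / (2 * M))) in L2 by (unfold c; field; lra).
    rewrite <- Rmult_plus_distr_l in L2.
    apply Rmult_le_reg_l in L1; [|exact Hc]. apply Rmult_le_reg_l in L2; [|exact Hc].
    assert (L3 : PI ^ 2 / (2 * M) <= PI ^ 2 * / (INR n + 1)).
    { apply Rmult_le_compat_l; [apply pow2_ge_0|]. apply Rinv_le_contravar; lra. }
    apply Rabs_le. lra. }
  apply is_lim_seq_unique in HA2. apply is_lim_seq_unique in HB.
  rewrite HA2 in HB. injection HB as HB. exact HB.
Qed.

(** The combination that eliminates the arguments 1/8 and 5/8 from [C]. As
    [sin (3 * PI / 8) = cos (PI / 8)], the double angle formulas at [PI / 4] evaluate it. *)
Lemma trigamma_eighths :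
  trigamma (1 / 8) + trigamma (7 / 8) - trigamma (3 / 8) - trigamma (5 / 8)
  = 4 * sqrt 2 * PI ^ 2.
Proof.
  assert (H1 := trigamma_reflection (1 / 8) ltac:(lra)).
  assert (H3 := trigamma_reflection (3 / 8) ltac:(lra)).
  replace (1 - 1 / 8) with (7 / 8) in H1 by lra.
  replace (1 - 3 / 8) with (5 / 8) in H3 by lra.
  replace (PI * (3 / 8)) with (PI / 2 - PI * (1 / 8)) in H3 by lra.
  rewrite sin_shift in H3.
  set (s := sin (PI * (1 / 8))) in *. set (c := cos (PI * (1 / 8))) in *.
  pose proof PI_RGT_0.
  assert (Hs : 0 < s) by (apply sin_gt_0; lra).
  assert (Hc : 0 < c) by (apply cos_gt_0; lra).
  assert (E1 : 2 * s * c = 1 / sqrt 2).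
  { unfold s, c. rewrite <- sin_2a. replace (2 * (PI * (1 / 8))) with (PI / 4) by lra.
    apply sin_PI4. }
  assert (E2 : c * c - s * s = 1 / sqrt 2).
  { unfold s, c. rewrite <- cos_2a. replace (2 * (PI * (1 / 8))) with (PI / 4) by lra.
    apply cos_PI4. }
  assert (Hr : 0 < sqrt 2) by (apply sqrt_lt_R0; lra).
  assert (Hr2 : sqrt 2 * sqrt 2 = 2) by (apply sqrt_sqrt; lra).
  transitivity (PI ^ 2 * ((c * c - s * s) / (s * c) ^ 2)).
  - replace (PI ^ 2 * ((c * c - s * s) / (s * c) ^ 2))
      with (PI ^ 2 / s ^ 2 - PI ^ 2 / c ^ 2) by (field; lra). lra.
  - rewrite E2. replace (s * c) with (1 / sqrt 2 / 2) by lra.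
    replace (1 / sqrt 2 / (1 / sqrt 2 / 2) ^ 2) with (4 * sqrt 2) by (field; lra). ring.
Qed.

(** * Factorization of 1 + y^m for odd m *)

Fixpoint prod_lt (f : nat -> R) (n : nat) : R :=
  match n with O => 1 | S n => prod_lt f n * f n end.

Lemma prod_lt_ext (f h : nat -> R) (n : nat) :
  (forall k, (k < n)%nat -> f k = h k) -> prod_lt f n = prod_lt h n.
Proof.
  induction n as [|n IH]; intro H; [reflexivity|].
  simpl. rewrite IH, (H n) by (intros; try apply H; lia). reflexivity.
Qed.

Lemma prod_lt_scal (c : R) (f : nat -> R) (n : nat) :
  prod_lt (fun k => c * f k) n = c ^ n * prod_lt f n.
Proof. induction n as [|n IH]; simpl; [|rewrite IH]; ring. Qed.

Lemma ln_prod_lt (f : nat -> R) (n : nat) :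
  (forall k, (k < n)%nat -> 0 < f k) ->
  0 < prod_lt f n /\ ln (prod_lt f n) = sum_lt (fun k => ln (f k)) n.
Proof.
  induction n as [|n IH]; intro H.
  - unfold sum_lt; simpl. split; [lra|apply ln_1].
  - destruct IH as [IH1 IH2]; [intros; apply H; lia|].
    assert (Hn : 0 < f n) by (apply H; lia).
    rewrite sum_lt_S, <- IH2. simpl. split.
    + apply Rmult_lt_0_compat; trivial.
    + apply ln_mult; trivial.
Qed.

(* [poly_lead n c f]: [f] is a polynomial function of degree at most [n], whose
   coefficient in degree [n] is [c]. *)
Fixpoint poly_lead (n : nat) (c : R) (f : R -> R) : Prop :=
  match n with
  | O => forall x, f x = c
  | S n => exists h d, poly_lead n c h /\ forall x, f x = x * h x + d
  end.

Lemma poly_lead_S0 (n : nat) (c : R) (f : R -> R) :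
  poly_lead n c f -> poly_lead (S n) 0 f.
Proof.
  revert f. induction n as [|n IH]; intros f H.
  - exists (fun _ => 0), c. split; [intro; reflexivity|]. intro x. rewrite (H x). ring.
  - destruct H as (h & d & Hh & Hf). exists h, d. split; [apply IH, Hh|exact Hf].
Qed.

Lemma poly_lead_minus (n : nat) (c d : R) (f h : R -> R) :
  poly_lead n c f -> poly_lead n d h -> poly_lead n (c - d) (fun x => f x - h x).
Proof.
  revert f h. induction n as [|n IH]; intros f h Hf Hh.
  - intro x. rewrite (Hf x), (Hh x). reflexivity.
  - destruct Hf as (f' & a & Hf' & Ef), Hh as (h' & b & Hh' & Eh).
    exists (fun x => f' x - h' x), (a - b). split; [apply IH; trivial|].
    intro x. rewrite Ef, Eh. ring.
Qed.

Lemma poly_lead_factor (n : nat) (c r : R) (f : R -> R) :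
  poly_lead (S n) c f ->
  exists h, poly_lead n c h /\ forall x, f x = (x - r) * h x + f r.
Proof.
  revert f. induction n as [|n IH]; intros f (h & d & Hh & Hf).
  - exists h. split; [exact Hh|]. intro x. rewrite !Hf, !Hh. ring.
  - destruct (IH h Hh) as (k & Hk & Eh).
    exists (fun x => x * k x + h r). split; [exists k, (h r); split; trivial|].
    intro x. rewrite !Hf, (Eh x). ring.
Qed.

Lemma poly_lead_roots (n : nat) (c : R) (f : R -> R) (r : nat -> R) :
  poly_lead n c f ->
  (forall k, (k < n)%nat -> f (r k) = 0) ->
  (forall i j, (i < j < n)%nat -> r i <> r j) ->
  forall x, f x = c * prod_lt (fun k => x - r k) n.
Proof.
  revert f. induction n as [|n IH]; intros f Hf Hr Hinj x.
  - rewrite (Hf x). simpl. ring.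
  - destruct (poly_lead_factor n c (r n) f Hf) as (h & Hh & E).
    rewrite (Hr n ltac:(lia)) in E.
    assert (Eh : forall x, h x = c * prod_lt (fun k => x - r k) n).
    { apply (IH h Hh).
      - intros k Hk. assert (H := E (r k)). rewrite (Hr k ltac:(lia)) in H.
        assert (Hne := Hinj k n ltac:(lia)).
        destruct (Rmult_integral (r k - r n) (h (r k))) as [H0|H0]; lra.
      - intros i j Hij. apply Hinj. lia. }
    rewrite E, Eh. simpl. ring.
Qed.

(* [y^n V_n (y + 1/y) = (1 + y^(2n+1)) / (1 + y)]. *)
Fixpoint chebyshev_V (n : nat) (x : R) : R :=
  match n with
  | O => 1
  | S p => match p with
           | O => x - 1
           | S q => x * chebyshev_V p x - chebyshev_V q x
           end
  end.

Lemma chebyshev_V_ind (P : nat -> Prop) :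
  P 0%nat -> P 1%nat -> (forall n, P n -> P (S n) -> P (S (S n))) -> forall n, P n.
Proof.
  intros H0 H1 HS n. enough (H : P n /\ P (S n)) by apply H.
  induction n as [|n [IH1 IH2]]; auto.
Qed.

Lemma chebyshev_V_lead (n : nat) : poly_lead n 1 (chebyshev_V n).
Proof.
  induction n as [| |n IH1 IH2] using chebyshev_V_ind.
  - intro x. reflexivity.
  - exists (fun _ => 1), (-1). split; [intro; reflexivity|]. intro x. simpl. ring.
  - replace 1 with (1 - 0) by ring.
    apply (poly_lead_minus _ _ _ (fun x => x * chebyshev_V (S n) x)).
    + exists (chebyshev_V (S n)), 0. split; [exact IH2|]. intro x. ring.
    + apply poly_lead_S0 with (c := 0), poly_lead_S0 with (c := 1), IH1.
Qed.

Lemma chebyshev_V_add_inv (n : nat) (y : R) : y <> 0 ->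
  y ^ n * chebyshev_V n (y + / y) * (1 + y) = 1 + y ^ (2 * n + 1).
Proof.
  intro Hy. induction n as [| |n IH1 IH2] using chebyshev_V_ind.
  - simpl. ring.
  - simpl. field. exact Hy.
  - replace (2 * S (S n) + 1)%nat with (4 + (2 * n + 1))%nat by lia.
    replace (2 * S n + 1)%nat with (2 + (2 * n + 1))%nat in IH2 by lia.
    rewrite (pow_add y 4). rewrite (pow_add y 2) in IH2.
    change (chebyshev_V (S (S n)) (y + / y))
      with ((y + / y) * chebyshev_V (S n) (y + / y) - chebyshev_V n (y + / y)).
    set (a := chebyshev_V (S n) (y + / y)) in *. set (b := chebyshev_V n (y + / y)) in *.
    replace (y ^ S (S n) * ((y + / y) * a - b) * (1 + y))
      with ((y ^ 2 + 1) * (y ^ S n * a * (1 + y)) - y ^ 2 * (y ^ n * b * (1 + y)))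
      by (simpl; field; exact Hy).
    rewrite IH1, IH2. ring.
Qed.

(** These are the Chebyshev polynomials of the third kind in the variable [2 * cos t]; their
    recursion is the product-to-sum formula. The zeros of the right side locate the roots. *)
Lemma chebyshev_V_cos (n : nat) (t : R) :
  chebyshev_V n (2 * cos t) * cos (t / 2) = cos ((2 * INR n + 1) * (t / 2)).
Proof.
  induction n as [| |n IH1 IH2] using chebyshev_V_ind.
  - simpl. rewrite Rmult_1_l. f_equal. ring.
  - simpl. replace ((2 * 1 + 1) * (t / 2)) with (t + t / 2) by field.
    assert (E1 := cos_plus t (t / 2)). assert (E2 := cos_minus t (t / 2)).
    replace (t - t / 2) with (t / 2) in E2 by field. lra.
  - change (chebyshev_V (S (S n)) (2 * cos t))
      with (2 * cos t * chebyshev_V (S n) (2 * cos t) - chebyshev_V n (2 * cos t)).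
    rewrite Rmult_minus_distr_r, Rmult_assoc, IH1, IH2, !S_INR.
    assert (E1 := cos_plus ((2 * (INR n + 1) + 1) * (t / 2)) t).
    assert (E2 := cos_minus ((2 * (INR n + 1) + 1) * (t / 2)) t).
    replace ((2 * (INR n + 1) + 1) * (t / 2) + t) with ((2 * (INR n + 1 + 1) + 1) * (t / 2))
      in E1 by field.
    replace ((2 * (INR n + 1) + 1) * (t / 2) - t) with ((2 * INR n + 1) * (t / 2))
      in E2 by field.
    lra.
Qed.

(** The index [k = n] would give exactly [PI], the root -1 that belongs to the separate factor
    [1 + y]. Strictness makes the cosines distinct and keeps [cos (t / 2)] away from 0. *)
Lemma phi_angle (n k : nat) : (k < n)%nat ->
  0 < (2 * INR k + 1) * PI / INR (2 * n + 1) < PI.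
Proof.
  intro Hk. pose proof PI_RGT_0. pose proof (pos_INR k).
  assert (Hn : INR (2 * n + 1) = 2 * INR n + 1) by (rewrite plus_INR, mult_INR; reflexivity).
  apply lt_INR in Hk. rewrite Hn. split.
  - apply Rdiv_lt_0_compat; nra.
  - apply Rmult_lt_reg_r with (2 * INR n + 1); [lra|].
    unfold Rdiv. rewrite Rmult_assoc, Rinv_l by lra. nra.
Qed.

(** The quotient by [1 + y] is palindromic, hence [y^n] times a polynomial in [y + 1/y]. That
    polynomial is monic with the [n] distinct roots [2 * phi_k], and each of its factors absorbs one
    [y]. *)
Lemma one_plus_pow_odd (n : nat) (y : R) : 0 < y ->
  1 + y ^ (2 * n + 1)
  = (1 + y) * prod_lt (fun k => 1 - 2 * phi (2 * n + 1) k * y + y ^ 2) n.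
Proof.
  intro Hy. rewrite <- chebyshev_V_add_inv by lra.
  rewrite (poly_lead_roots n 1 _ (fun k => 2 * phi (2 * n + 1) k) (chebyshev_V_lead n)).
  - rewrite Rmult_1_l, <- prod_lt_scal, Rmult_comm. f_equal.
    apply prod_lt_ext. intros k _. field. lra.
  - intros k Hk. assert (Ha := phi_angle n k Hk). unfold phi.
    set (t := (2 * INR k + 1) * PI / INR (2 * n + 1)) in *.
    assert (E := chebyshev_V_cos n t).
    assert (Hc : 0 < cos (t / 2)) by (apply cos_gt_0; lra).
    assert (E0 : cos ((2 * INR n + 1) * (t / 2)) = 0).
    { apply cos_eq_0_1. exists (Z.of_nat k). rewrite <- INR_IZR_INZ.
      unfold t. rewrite plus_INR, mult_INR. simpl. pose proof (pos_INR n). field. lra. }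
    rewrite E0 in E. apply Rmult_integral in E. destruct E; lra.
  - intros i j Hij. unfold phi.
    assert (Hi := phi_angle n i ltac:(lia)). assert (Hj := phi_angle n j ltac:(lia)).
    enough (cos ((2 * INR j + 1) * PI / INR (2 * n + 1))
            < cos ((2 * INR i + 1) * PI / INR (2 * n + 1))) by lra.
    apply cos_decreasing_1; try lra.
    apply Rmult_lt_compat_r; [apply Rinv_0_lt_compat, lt_0_INR; lia|].
    apply Rmult_lt_compat_r; [apply PI_RGT_0|].
    destruct Hij as [Hij _]. apply lt_INR in Hij. lra.
Qed.

(** * The logarithmic integral *)

Lemma is_derive_pow_div (n : nat) (c x : R) : INR n + 1 = c ->
  is_derive (fun x => x ^ S n / c) x (x ^ n).
Proof.
  intros <-. pose proof (pos_INR n). auto_derive; [exact I|].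
  change (match n with O => 1 | S _ => INR n + 1 end) with (INR (S n)).
  rewrite S_INR. field. lra.
Qed.

Lemma is_RInt_pow_unit (n : nat) : is_RInt (fun x => x ^ n) 0 1 (/ (INR n + 1)).
Proof.
  replace (/ (INR n + 1)) with (1 ^ S n / INR (S n) - 0 ^ S n / INR (S n)).
  - apply is_RInt_pow.
  - rewrite pow1, pow_i, S_INR by lia. pose proof (pos_INR n). field. lra.
Qed.

Lemma is_RInt_abs_le (f h : R -> R) (lf lh : R) :
  is_RInt f 0 1 lf -> is_RInt h 0 1 lh ->
  (forall x, 0 < x < 1 -> Rabs (f x) <= h x) -> Rabs lf <= lh.
Proof.
  intros Hf Hh H.
  rewrite <- (is_RInt_unique _ _ _ _ Hf), <- (is_RInt_unique _ _ _ _ Hh).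
  apply Rabs_le. split.
  - rewrite <- (RInt_opp (V := R_CompleteNormedModule) h) by (eexists; exact Hh).
    apply RInt_le; [lra|apply (ex_RInt_opp (V := R_NormedModule))| |]; try (eexists; eassumption).
    intros x Hx. specialize (H x Hx). apply Rabs_le_between in H. apply H.
  - apply RInt_le; [lra|eexists; eassumption|eexists; eassumption|].
    intros x Hx. specialize (H x Hx). apply Rabs_le_between in H. apply H.
Qed.

(** The factor [D_a] of the overview; [kern] below is the weight, and [log_int] is [H]. *)
Definition quart (a x : R) : R := (1 - x ^ 2) ^ 2 + a ^ 2 * x ^ 2.

Definition kern (x : R) : R := (1 + x ^ 2) / (1 + x ^ 4).

Lemma quart_pos (a x : R) : 0 < a -> 0 < quart a x.
Proof.
  intro Ha. unfold quart. destruct (Req_dec x 0) as [-> |Hx]; [simpl; lra|].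
  assert (0 < a ^ 2) by (apply pow_lt, Ha).
  assert (0 < x ^ 2) by (apply pow2_gt_0, Hx).
  pose proof (pow2_ge_0 (1 - x ^ 2)). nra.
Qed.

Lemma sqrt2_pos : 0 < sqrt 2.
Proof. apply sqrt_lt_R0. lra. Qed.

Lemma sqrt2_sq : sqrt 2 ^ 2 = 2.
Proof. simpl. rewrite Rmult_1_r. apply sqrt_sqrt. lra. Qed.

Lemma quart_sqrt2 (x : R) : quart (sqrt 2) x = 1 + x ^ 4.
Proof. unfold quart. rewrite sqrt2_sq. ring. Qed.

Lemma one_plus_pow4_pos (x : R) : 0 < 1 + x ^ 4.
Proof. rewrite <- quart_sqrt2. apply quart_pos, sqrt2_pos. Qed.

Lemma kern_bounds (x : R) : 0 <= kern x <= 2.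
Proof.
  unfold kern. pose proof (one_plus_pow4_pos x). pose proof (pow2_ge_0 x). split.
  - apply Rdiv_le_0_compat; lra.
  - apply Rmult_le_reg_r with (1 + x ^ 4); [trivial|].
    unfold Rdiv. rewrite Rmult_assoc, Rinv_l by lra.
    replace (x ^ 4) with (x ^ 2 * x ^ 2) by ring. nra.
Qed.

Lemma kern_continuous (x : R) : continuous kern x.
Proof.
  apply (ex_derive_continuous kern). unfold kern. auto_derive.
  pose proof (one_plus_pow4_pos x). simpl in *. lra.
Qed.

(** The substitution [u = x / (1 - x^2)] turns the integrand into [1 / (1 + a^2 u^2)], but the
    primitive [atan (a * u) / a] breaks down at [x = 1]. The half-angle formula [atan z = 2 * atan
    (z / (1 + sqrt (1 + z^2)))] gives the primitive [F], smooth on all of [0, 1]. *)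
Lemma is_RInt_inv_quart (a : R) : 0 < a ->
  is_RInt (fun x => (1 + x ^ 2) / quart a x) 0 1 (PI / (2 * a)).
Proof.
  intro Ha.
  set (w := fun x => 1 - x ^ 2 + sqrt (quart a x)).
  set (F := fun x => 2 / a * atan (a * x / w x)).
  assert (Hr : forall x, 0 < sqrt (quart a x)) by (intro; apply sqrt_lt_R0, quart_pos, Ha).
  assert (E1 : F 1 = PI / (2 * a)).
  { unfold F, w. replace (quart a 1) with (a ^ 2) by (unfold quart; ring).
    rewrite sqrt_pow2 by lra.
    replace (a * 1 / (1 - 1 ^ 2 + a)) with 1 by (field; lra).
    rewrite atan_1. field. lra. }
  assert (E0 : F 0 = 0).
  { unfold F. rewrite Rmult_0_r. unfold Rdiv. rewrite Rmult_0_l, atan_0. ring. }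
  replace (PI / (2 * a)) with (F 1 - F 0) by (rewrite E1, E0; ring).
  apply (is_RInt_derive F).
  - intros x Hx. rewrite Rmin_left, Rmax_right in Hx by lra.
    assert (Hq := quart_pos a x Ha). assert (Hrx := Hr x).
    assert (Hsq : sqrt (quart a x) * sqrt (quart a x) = quart a x) by (apply sqrt_sqrt; lra).
    assert (Hw : 0 < w x) by (unfold w; nra).
    set (r := sqrt (quart a x)) in *.
    set (q' := -4 * x * (1 - x ^ 2) + 2 * a ^ 2 * x).
    set (w' := - 2 * x + q' / (2 * r)).
    assert (Dq : is_derive (quart a) x q').
    { unfold quart, q'. auto_derive; [exact I|ring]. }
    assert (Dw : is_derive w x w').
    { unfold w, w'. apply (is_derive_plus (K := R_AbsRing) (V := R_NormedModule)
                             (fun x => 1 - x ^ 2)).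
      - auto_derive; [exact I|ring].
      - apply is_derive_sqrt; trivial. }
    assert (DF : is_derive F x (2 / a * ((a * w x - a * x * w') / w x ^ 2
                                          * / (1 + (a * x / w x)²)))).
    { unfold F. apply is_derive_scal.
      apply (is_derive_comp atan (fun x => a * x / w x)); [apply is_derive_atan|].
      apply is_derive_div; [auto_derive; [exact I|ring]|exact Dw|lra]. }
    replace ((1 + x ^ 2) / quart a x) with (2 / a * ((a * w x - a * x * w') / w x ^ 2
                                          * / (1 + (a * x / w x)²))); [exact DF|].
    unfold Rsqr.
    assert (K1 : w x * w x + a * x * (a * x) = 2 * r * w x).
    { unfold w. fold r. replace (a * x * (a * x)) with (quart a x - (1 - x ^ 2) ^ 2)
        by (unfold quart; ring). rewrite <- Hsq. ring. }
    assert (K2 : (w x - x * w') * r = (1 + x ^ 2) * w x).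
    { replace ((w x - x * w') * r) with (w x * r + 2 * x ^ 2 * r - x * q' / 2)
        by (unfold w'; field; lra).
      replace (w x * r) with ((1 - x ^ 2) * r + r * r) by (unfold w; fold r; ring).
      rewrite Hsq. unfold w. fold r. unfold q', quart. field. }
    replace (2 / a * ((a * w x - a * x * w') / w x ^ 2 * / (1 + a * x / w x * (a * x / w x))))
      with (2 * ((w x - x * w') * r) / (r * (w x * w x + a * x * (a * x)))).
    + rewrite K1, K2, <- Hsq. field. lra.
    + pose proof (Rle_0_sqr (a * x)) as Hp. unfold Rsqr in Hp. field.
      repeat split; try lra; nra.
  - intros x _. apply (ex_derive_continuous (fun x => (1 + x ^ 2) / quart a x)).
    assert (Hq := quart_pos a x Ha). unfold quart in *. auto_derive. lra.
Qed.

Lemma is_RInt_kern : is_RInt kern 0 1 (PI / (2 * sqrt 2)).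
Proof.
  apply (is_RInt_ext (fun x => (1 + x ^ 2) / quart (sqrt 2) x)).
  - intros x _. rewrite quart_sqrt2. reflexivity.
  - apply is_RInt_inv_quart, sqrt2_pos.
Qed.

(** Partial fractions: [1 + x^4 - quart a x = (2 - a^2) * x^2], so the integrand is a multiple of
    the difference of two integrands already known. The multiple is singular at [a = sqrt 2], a
    value that cannot be skipped since [log_int (sqrt 2)] itself occurs in the factorization. *)
Lemma is_RInt_kern_quart' (a : R) : 0 < a ->
  is_RInt (fun x => kern x * (2 * a * x ^ 2 / quart a x)) 0 1 (PI / sqrt 2 / (a + sqrt 2)).
Proof.
  intro Ha. pose proof sqrt2_pos as H2. pose proof sqrt2_sq as H22.
  destruct (Req_dec a (sqrt 2)) as [-> |Hne].
  (* [F] vanishes at 0 and at 1, so its derivative equates the integral with the double pole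
     [(1 + x^4)^2] to the integral of [kern]. *)
  - set (F := fun x => x * (x ^ 2 - 1) / (1 + x ^ 4)).
    set (F' := fun x => 4 * (x ^ 2 * (1 + x ^ 2) / (1 + x ^ 4) ^ 2) - kern x).
    assert (HF : is_RInt F' 0 1 (F 1 - F 0)).
    { apply (is_RInt_derive F F').
      - intros x _. pose proof (one_plus_pow4_pos x). unfold F, F', kern.
        auto_derive; [simpl in *; lra|field; simpl in *; lra].
      - intros x _. apply (ex_derive_continuous F'). pose proof (one_plus_pow4_pos x).
        unfold F', kern. auto_derive. simpl in *.
        split; [|split; [lra|exact I]]. apply Rgt_not_eq. nra. }
    replace (F 1 - F 0) with 0 in HF by (unfold F; field).
    assert (HK := is_RInt_scal (V := R_NormedModule) _ _ _ (sqrt 2 / 2) _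
                    (is_RInt_plus (V := R_NormedModule) _ _ _ _ _ _ HF is_RInt_kern)).
    replace (PI / sqrt 2 / (sqrt 2 + sqrt 2))
      with (scal (sqrt 2 / 2) (plus 0 (PI / (2 * sqrt 2)))).
    2: { unfold scal, plus; simpl; unfold mult; simpl.
         replace (PI / sqrt 2 / (sqrt 2 + sqrt 2)) with (PI / (2 * sqrt 2 ^ 2)) by (field; lra).
         rewrite H22. field. lra. }
    revert HK. apply is_RInt_ext. intros x _.
    unfold scal, plus; simpl; unfold mult; simpl. rewrite quart_sqrt2. unfold F', kern.
    pose proof (one_plus_pow4_pos x). field. simpl in *. lra.
  - assert (Hd : 2 - a ^ 2 <> 0).
    { rewrite <- H22. intro E. apply Hne.
      assert (E' : (sqrt 2 - a) * (sqrt 2 + a) = 0) by (rewrite <- E; ring).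
      apply Rmult_integral in E'. destruct E'; lra. }
    assert (HK := is_RInt_scal (V := R_NormedModule) _ _ _ (2 * a / (2 - a ^ 2)) _
                    (is_RInt_minus (V := R_NormedModule) _ _ _ _ _ _
                       (is_RInt_inv_quart a Ha) is_RInt_kern)).
    replace (PI / sqrt 2 / (a + sqrt 2))
      with (scal (2 * a / (2 - a ^ 2)) (minus (PI / (2 * a)) (PI / (2 * sqrt 2)))).
    2: { unfold scal, minus, plus, opp; simpl; unfold mult; simpl.
         replace (2 - a * (a * 1)) with ((sqrt 2 - a) * (sqrt 2 + a))
           by (transitivity (sqrt 2 ^ 2 - a ^ 2); [ring|rewrite H22; ring]).
         field. repeat split; lra. }
    revert HK. apply is_RInt_ext. intros x _.
    unfold scal, minus, plus, opp; simpl; unfold mult; simpl.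
    pose proof (quart_pos a x Ha). pose proof (one_plus_pow4_pos x).
    unfold kern. apply Rminus_diag_uniq.
    field_simplify; [|simpl in *; lra]. unfold quart.
    match goal with |- ?n / ?d = 0 => replace n with 0 by ring end.
    unfold Rdiv. apply Rmult_0_l.
Qed.

Definition log_int (a : R) : R := RInt (fun x => kern x * ln (quart a x)) 0 1.

Lemma is_RInt_log_int (a : R) : 0 < a ->
  is_RInt (fun x => kern x * ln (quart a x)) 0 1 (log_int a).
Proof.
  intro Ha. apply (RInt_correct (V := R_CompleteNormedModule)).
  apply (ex_RInt_continuous (V := R_CompleteNormedModule)). intros x _.
  apply (continuous_mult (K := R_AbsRing)); [apply kern_continuous|].
  apply (ex_derive_continuous (fun x => ln (quart a x))).
  assert (H := quart_pos a x Ha). unfold quart in *. auto_derive. simpl in *. lra.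
Qed.

Lemma is_derive_log_int (a : R) : 0 < a -> is_derive log_int a (PI / sqrt 2 / (a + sqrt 2)).
Proof.
  intro Ha.
  assert (Hloc : locally a (fun u => 0 < u)).
  { exists (mkposreal a Ha). intros y Hy. apply ball_R in Hy; simpl in Hy. lra. }
  assert (Hd : forall u t, 0 < u ->
    is_derive (fun u => kern t * ln (quart u t)) u (kern t * (2 * u * t ^ 2 / quart u t))).
  { intros u t Hu. apply is_derive_scal. assert (H := quart_pos u t Hu).
    unfold quart in *. auto_derive; [simpl in *; lra|field; simpl in *; lra]. }
  rewrite <- (is_RInt_unique _ _ _ _ (is_RInt_kern_quart' a Ha)).
  rewrite (RInt_ext _ (fun t => Derive (fun u => kern t * ln (quart u t)) a)).
  2: { intros t _. symmetry. apply is_derive_unique, Hd, Ha. }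
  apply (is_derive_RInt_param (fun u t => kern t * ln (quart u t)) 0 1 a).
  - revert Hloc. apply filter_imp. intros u Hu t _. eexists. apply Hd, Hu.
  - intros t _.
    apply (continuity_2d_pt_ext_loc (fun u v => kern v * (2 * u * v ^ 2 / quart u v))).
    { exists (mkposreal a Ha). intros u v Hu _. simpl in Hu. apply Rabs_def2 in Hu.
      symmetry. apply is_derive_unique, Hd. lra. }
    unfold Rdiv, quart. apply continuity_2d_pt_mult.
    { apply (continuity_1d_2d_pt_comp kern (fun _ v => v)).
      - apply continuity_pt_filterlim, kern_continuous.
      - apply continuity_2d_pt_id2. }
    apply continuity_2d_pt_mult.
    { simpl.
      repeat first [ apply continuity_2d_pt_const | apply continuity_2d_pt_id1
                   | apply continuity_2d_pt_id2 | apply continuity_2d_pt_mult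
                   | apply continuity_2d_pt_plus | apply continuity_2d_pt_opp ]. }
    apply continuity_2d_pt_inv.
    { simpl.
      repeat first [ apply continuity_2d_pt_const | apply continuity_2d_pt_id1
                   | apply continuity_2d_pt_id2 | apply continuity_2d_pt_mult
                   | apply continuity_2d_pt_plus | apply continuity_2d_pt_opp ]. }
    apply Rgt_not_eq, (quart_pos a t Ha).
  - revert Hloc. apply filter_imp. intros u Hu. eexists. apply is_RInt_log_int, Hu.
Qed.

(** * The additive constant of the logarithmic integral *)

Definition kern_prim (x : R) : R := RInt kern 0 x.

Lemma is_derive_kern_prim (x : R) : is_derive kern_prim x (kern x).
Proof.
  apply (is_derive_RInt kern kern_prim 0); [|apply kern_continuous].
  apply filter_forall. intro y. apply (RInt_correct (V := R_CompleteNormedModule)).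
  apply (ex_RInt_continuous (V := R_CompleteNormedModule)). intros; apply kern_continuous.
Qed.

Lemma kern_prim_0 : kern_prim 0 = 0.
Proof. apply (RInt_point 0 kern). Qed.

Lemma kern_prim_1 : kern_prim 1 = PI / (2 * sqrt 2).
Proof. apply is_RInt_unique, is_RInt_kern. Qed.

Lemma kern_prim_bound (x : R) : 0 <= x -> Rabs (kern_prim x) <= 2 * x.
Proof.
  intro Hx. replace (kern_prim x) with (kern_prim x - kern_prim 0)
    by (rewrite kern_prim_0; ring).
  replace (2 * x) with (2 * x - 2 * 0) by ring.
  apply (abs_le_of_derive kern_prim (fun t => 2 * t) kern (fun _ => 2)); trivial.
  - intros; apply is_derive_kern_prim.
  - intros t _. auto_derive; [exact I|ring].
  - intros t _. pose proof (kern_bounds t). rewrite Rabs_pos_eq; lra.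
Qed.

(** The mean of [kern] over [0, x], extended continuously by [kern 0 = 1]. Twice its integral over
    [0, 1] is the constant [C]. *)
Definition kern_mean (x : R) : R := if Req_EM_T x 0 then 1 else kern_prim x / x.

Lemma kern_mean_mul (x : R) : x * kern_mean x = kern_prim x.
Proof.
  unfold kern_mean. destruct (Req_EM_T x 0) as [-> |Hx].
  - rewrite kern_prim_0. ring.
  - field. exact Hx.
Qed.

Lemma kern_mean_continuous (x : R) : continuous kern_mean x.
Proof.
  destruct (Req_dec x 0) as [-> |Hx].
  - apply continuity_pt_filterlim.
    assert (H := is_derive_kern_prim 0). apply is_derive_Reals in H.
    replace (kern 0) with 1 in H by (unfold kern; field).
    intros eps Heps. destruct (H eps Heps) as [d Hd].
    exists d. split; [apply cond_pos|]. intros y [[_ Hy] Hyd]. simpl in *.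
    unfold Rdist in *. rewrite Rminus_0_r in Hyd.
    specialize (Hd y (not_eq_sym Hy) Hyd). rewrite Rplus_0_l, kern_prim_0, Rminus_0_r in Hd.
    unfold kern_mean. destruct (Req_EM_T 0 0) as [_|]; [|lra].
    destruct (Req_EM_T y 0); [lra|exact Hd].
  - apply (continuous_ext_loc _ (fun y => kern_prim y / y)).
    + assert (Hp : 0 < Rabs x) by (apply Rabs_pos_lt, Hx).
      exists (mkposreal _ Hp). intros y Hy. change (Rabs (y - x) < Rabs x) in Hy.
      unfold kern_mean. destruct (Req_EM_T y 0) as [-> |]; [|reflexivity].
      rewrite Rminus_0_l, Rabs_Ropp in Hy. lra.
    + apply (ex_derive_continuous (fun y => kern_prim y / y)).
      apply ex_derive_div; [eexists; apply is_derive_kern_prim|apply ex_derive_id|exact Hx].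
Qed.

Lemma ex_RInt_kern_mean : ex_RInt kern_mean 0 1.
Proof.
  apply (ex_RInt_continuous (V := R_CompleteNormedModule)). intros; apply kern_mean_continuous.
Qed.

(* Integrate by parts against [kern_prim]; as [a] grows, the logarithmic derivative of
   [quart a] tends to [2 / x] in the mean. *)
Lemma log_int_asymptotic (a : R) : 0 < a ->
  Rabs (log_int a - PI / sqrt 2 * ln a + 2 * RInt kern_mean 0 1) <= 2 * PI / a.
Proof.
  intro Ha.
  set (q' := fun x => -4 * x * (1 - x ^ 2) + 2 * a ^ 2 * x).
  assert (Hparts : is_RInt (fun x => kern_prim x * (q' x / quart a x)) 0 1
            (kern_prim 1 * ln (quart a 1) - kern_prim 0 * ln (quart a 0) - log_int a)).
  { apply (is_RInt_scal_derive_r (V := R_CompleteNormedModule)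
             kern_prim (fun x => ln (quart a x)) kern (fun x => q' x / quart a x)).
    - intros t _. apply is_derive_kern_prim.
    - intros t _. assert (H := quart_pos a t Ha). unfold quart, q' in *.
      auto_derive; [simpl in *; lra|field; simpl in *; lra].
    - intros t _. apply kern_continuous.
    - intros t _. apply (ex_derive_continuous (fun x => q' x / quart a x)).
      assert (H := quart_pos a t Ha). unfold quart, q' in *. auto_derive. simpl in *. lra.
    - apply is_RInt_log_int, Ha. }
  assert (Hm := is_RInt_scal (V := R_NormedModule) _ _ _ 2 _
                  (RInt_correct (V := R_CompleteNormedModule) _ _ _ ex_RInt_kern_mean)).
  assert (Hdiff := is_RInt_minus (V := R_NormedModule) _ _ _ _ _ _ Hm Hparts).
  assert (Hbd := is_RInt_scal (V := R_NormedModule) _ _ _ 4 _ (is_RInt_inv_quart a Ha)).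
  replace (log_int a - PI / sqrt 2 * ln a + 2 * RInt kern_mean 0 1)
    with (minus (scal 2 (RInt kern_mean 0 1))
            (kern_prim 1 * ln (quart a 1) - kern_prim 0 * ln (quart a 0) - log_int a)).
  2: { unfold minus, plus, opp, scal; simpl; unfold mult; simpl.
       rewrite kern_prim_0, kern_prim_1. replace (quart a 1) with (a * a) by (unfold quart; ring).
       rewrite ln_mult by trivial. pose proof sqrt2_pos. field. lra. }
  replace (2 * PI / a) with (scal 4 (PI / (2 * a)))
    by (unfold scal; simpl; unfold mult; simpl; field; lra).
  refine (is_RInt_abs_le _ _ _ _ Hdiff Hbd _).
  intros x Hx.
  unfold minus, plus, opp, scal; simpl; unfold mult; simpl.
  pose proof (quart_pos a x Ha) as Hq.
  (* With [kern_prim x = x * kern_mean x], the numerator is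
     [2 * quart a x - x * q' x = 2 * (1 - x^4)], free of [a]. Then [kern_mean <= 2] and
     [1 - x^4 <= 1 + x^2] bound the difference by 4 times the integrand of [is_RInt_inv_quart], of
     integral [PI / (2 * a)]. *)
  replace (2 * kern_mean x + - (kern_prim x * (q' x / quart a x)))
    with (kern_mean x * (2 * (1 - x ^ 4) / quart a x)).
  2: { rewrite <- (kern_mean_mul x). unfold q', quart in *. field. simpl in *. lra. }
  assert (Hmb : Rabs (kern_mean x) <= 2).
  { unfold kern_mean. destruct (Req_EM_T x 0) as [_|Hx0]; [rewrite Rabs_R1; lra|].
    unfold Rdiv. rewrite Rabs_mult, (Rabs_pos_eq (/ x)) by (apply Rlt_le, Rinv_0_lt_compat; lra).
    apply Rmult_le_reg_r with x; [lra|]. rewrite Rmult_assoc, Rinv_l, Rmult_1_r by exact Hx0.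
    apply kern_prim_bound. lra. }
  assert (Hx2 : 0 <= x ^ 2 <= 1).
  { split; [apply pow2_ge_0|]. replace 1 with (1 ^ 2) by ring. apply pow_incr; lra. }
  assert (H4 : 0 <= 1 - x ^ 4 <= 1 + x ^ 2).
  { replace (x ^ 4) with (x ^ 2 * x ^ 2) by ring. nra. }
  rewrite Rabs_mult, (Rabs_pos_eq (2 * (1 - x ^ 4) / quart a x))
    by (apply Rdiv_le_0_compat; lra).
  replace (4 * ((1 + x * (x * 1)) / quart a x))
    with (2 * (2 * (1 + x ^ 2) / quart a x)) by (field; lra).
  apply Rmult_le_compat; trivial.
  - apply Rabs_pos.
  - apply Rdiv_le_0_compat; lra.
  - apply Rmult_le_compat_r; [apply Rlt_le, Rinv_0_lt_compat, Hq|lra].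
Qed.

Lemma log_int_eq (a : R) : 0 < a ->
  log_int a = PI / sqrt 2 * ln (a + sqrt 2) - 2 * RInt kern_mean 0 1.
Proof.
  intro Ha. pose proof sqrt2_pos as H2. pose proof PI_RGT_0 as HPI.
  set (F := fun b => log_int b - PI / sqrt 2 * ln (b + sqrt 2)).
  assert (HF : forall b, 0 < b -> is_derive F b 0).
  { intros b Hb. unfold F.
    replace 0 with (PI / sqrt 2 / (b + sqrt 2) - PI / sqrt 2 * (1 / (b + sqrt 2)))
      by (field; lra).
    apply (is_derive_minus (K := R_AbsRing) (V := R_NormedModule) log_int).
    - apply is_derive_log_int, Hb.
    - auto_derive; [lra|field; lra]. }
  assert (Hcst : forall b, a <= b -> F b = F a).
  { intros b Hb.
    assert (H := abs_le_of_derive F (fun _ => 0) (fun _ => 0) (fun _ => 0) a b Hb).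
    rewrite Rminus_diag in H. apply Rminus_diag_uniq.
    assert (H0 : Rabs (F b - F a) <= 0).
    { apply H.
      - intros t Ht. apply HF. lra.
      - intros t _. apply (is_derive_const (K := R_AbsRing) (V := R_NormedModule)).
      - intros t _. rewrite Rabs_R0. lra. }
    pose proof (Rabs_pos (F b - F a)). apply Rabs_eq_0. lra. }
  enough (E : F a + 2 * RInt kern_mean 0 1 = 0) by (unfold F in E; lra).
  (* [F] is constant, so it may be evaluated at a large [b]. Of the bound, [2 * PI / b] is the error
     in [log_int_asymptotic] and [PI / b] the cost of replacing [ln b] by [ln (b + sqrt 2)]. *)
  assert (Hlim : forall b, a <= b -> Rabs (F a + 2 * RInt kern_mean 0 1) <= 3 * PI / b).
  { intros b Hb. rewrite <- (Hcst b Hb).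
    assert (A1 := log_int_asymptotic b ltac:(lra)).
    assert (A2 := ln_minus_bounds b (b + sqrt 2) ltac:(lra) ltac:(lra)).
    replace (b + sqrt 2 - b) with (sqrt 2) in A2 by ring.
    assert (A3 : 0 < sqrt 2 / (b + sqrt 2)) by (apply Rdiv_lt_0_compat; lra).
    assert (Hk : 0 < PI / sqrt 2) by (apply Rdiv_lt_0_compat; lra).
    assert (A4 : 0 <= PI / sqrt 2 * (ln (b + sqrt 2) - ln b) <= PI / b).
    { split; [apply Rmult_le_pos; lra|].
      replace (PI / b) with (PI / sqrt 2 * (sqrt 2 / b)) by (field; lra).
      apply Rmult_le_compat_l; lra. }
    replace (3 * PI / b) with (2 * PI / b + PI / b) by (field; lra).
    unfold F. apply Rabs_le. apply Rabs_le_between in A1. lra. }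
  destruct (Req_dec (F a + 2 * RInt kern_mean 0 1) 0) as [E|E]; [exact E|exfalso].
  apply Rabs_pos_lt in E. set (e := Rabs (F a + 2 * RInt kern_mean 0 1)) in *.
  set (b := Rmax a (4 * PI / e)).
  assert (H4 : 4 * PI / e <= b) by apply Rmax_r.
  specialize (Hlim b (Rmax_l _ _)).
  assert (Hb : 0 < b) by (pose proof (Rmax_l a (4 * PI / e)); unfold b; lra).
  apply (Rmult_le_compat_r b) in Hlim; [|lra].
  apply (Rmult_le_compat_r e) in H4; [|lra].
  replace (3 * PI / b * b) with (3 * PI) in Hlim by (field; lra).
  replace (4 * PI / e * e) with (4 * PI) in H4 by (field; lra).
  lra.
Qed.

(** Since [kern x = (1 + x^2) * (1 - x^4) / (1 - x^8)], it expands in blocks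
    [x^(8k) * (1 + x^2 - x^4 - x^6)] with exact remainder [kern x * x^(8n)]. Taking the mean and
    then integrating divides twice by each exponent plus one, whence the squares. *)
Lemma RInt_kern_mean :
  2 * RInt kern_mean 0 1 = PI ^ 2 * sqrt 2 / 8 - (trigamma (7 / 8) - trigamma (3 / 8)) / 16.
Proof.
  set (s := fun k => 1 / (8 * INR k + 1) ^ 2 + 1 / (8 * INR k + 3) ^ 2
                     - 1 / (8 * INR k + 5) ^ 2 - 1 / (8 * INR k + 7) ^ 2).
  assert (L1 : is_lim_seq (sum_lt s)
    (/ 64 * (trigamma (1 / 8) + trigamma (3 / 8) - trigamma (5 / 8) - trigamma (7 / 8)))).
  { apply (is_lim_seq_ext (fun n => / 64 * (sum_lt (fun k => / (1 / 8 + INR k) ^ 2) n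
                                            + sum_lt (fun k => / (3 / 8 + INR k) ^ 2) n
                                            - sum_lt (fun k => / (5 / 8 + INR k) ^ 2) n
                                            - sum_lt (fun k => / (7 / 8 + INR k) ^ 2) n))).
    - intro n. induction n as [|n IH]; [unfold sum_lt; simpl; ring|].
      rewrite !sum_lt_S, <- IH. unfold s. pose proof (pos_INR n). field. lra.
    - apply (is_lim_seq_scal_l _ (/ 64)
               (trigamma (1 / 8) + trigamma (3 / 8) - trigamma (5 / 8) - trigamma (7 / 8))).
      apply is_lim_seq_minus'; [apply is_lim_seq_minus'; [apply is_lim_seq_plus'|]|];
        apply is_lim_trigamma; lra. }
  assert (L2 : is_lim_seq (sum_lt s) (RInt kern_mean 0 1)).
  (* [T] is the termwise primitive of a block and [t] is [T] divided by [x], written out so that it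
     makes sense at 0. *)
  { set (t := fun k x => x ^ (8 * k) / (8 * INR k + 1) + x ^ (8 * k + 2) / (8 * INR k + 3)
                 - x ^ (8 * k + 4) / (8 * INR k + 5) - x ^ (8 * k + 6) / (8 * INR k + 7)).
    set (T := fun k x => x ^ (8 * k + 1) / (8 * INR k + 1) + x ^ (8 * k + 3) / (8 * INR k + 3)
                 - x ^ (8 * k + 5) / (8 * INR k + 5) - x ^ (8 * k + 7) / (8 * INR k + 7)).
    assert (HT : forall n x, x * sum_lt (fun k => t k x) n = sum_lt (fun k => T k x) n).
    { intros n x. rewrite <- sum_lt_scal. apply sum_lt_ext. intros k _. unfold t, T.
      rewrite !pow_add. unfold Rdiv. ring. }
    assert (Dpow : forall k j x, is_derive (fun x => x ^ (8 * k + S j) / (8 * INR k + INR (S j)))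
                                   x (x ^ (8 * k + j))).
    { intros k j x. rewrite Nat.add_succ_r. apply is_derive_pow_div.
      rewrite S_INR, plus_INR, mult_INR. simpl (INR 8). ring. }
    assert (DT : forall n x, is_derive (fun x => sum_lt (fun k => T k x) n) x
                               (kern x - kern x * x ^ (8 * n))).
    { intros n x.
      replace (kern x - kern x * x ^ (8 * n))
        with (sum_lt (fun k => x ^ (8 * k) + x ^ (8 * k + 2)
                               - x ^ (8 * k + 4) - x ^ (8 * k + 6)) n).
      - apply (is_derive_sum_lt T (fun k x => x ^ (8 * k) + x ^ (8 * k + 2)
                               - x ^ (8 * k + 4) - x ^ (8 * k + 6))).
        intros k _. unfold T.
        assert (D0 := Dpow k 0%nat x). assert (D2 := Dpow k 2%nat x).
        assert (D4 := Dpow k 4%nat x). assert (D6 := Dpow k 6%nat x).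
        rewrite Nat.add_0_r in D0.
        change (INR 1) with 1 in D0. replace (INR 3) with 3 in D2 by (simpl; ring).
        replace (INR 5) with 5 in D4 by (simpl; ring).
        replace (INR 7) with 7 in D6 by (simpl; ring).
        exact (is_derive_minus (K := R_AbsRing) (V := R_NormedModule) _ _ _ _ _
                 (is_derive_minus (K := R_AbsRing) (V := R_NormedModule) _ _ _ _ _
                   (is_derive_plus (K := R_AbsRing) (V := R_NormedModule) _ _ _ _ _ D0 D2)
                   D4) D6).
      - pose proof (one_plus_pow4_pos x) as H4.
        induction n as [|n IH].
        + unfold sum_lt; simpl. ring.
        + rewrite sum_lt_S, IH. replace (8 * S n)%nat with (8 * n + 8)%nat by lia.
          rewrite !pow_add. unfold kern. field. simpl in *. lra. }
    (* The factor [x] is kept in front on the right: cancelling it turns this estimate for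
       [kern_prim] and [T] into one for [kern_mean] and [t]. *)
    assert (Hpw : forall n x, 0 <= x ->
      Rabs (kern_prim x - sum_lt (fun k => T k x) n) <= x * (2 / (8 * INR n + 1) * x ^ (8 * n))).
    { intros n x Hx. pose proof (pos_INR n) as Hn.
      assert (H := abs_le_of_derive (fun x => kern_prim x - sum_lt (fun k => T k x) n)
        (fun x => 2 * (x ^ (8 * n + 1) / (8 * INR n + INR 1))) (fun x => kern x * x ^ (8 * n))
        (fun x => 2 * x ^ (8 * n)) 0 x Hx).
      cbv beta in H.
      rewrite <- (HT n 0), Rmult_0_l, kern_prim_0, !Rminus_0_r in H.
      rewrite (pow_i (8 * n + 1)) in H by lia.
      replace (2 * (0 / (8 * INR n + INR 1))) with 0 in H by (unfold Rdiv; ring).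
      rewrite Rminus_0_r in H.
      replace (x * (2 / (8 * INR n + 1) * x ^ (8 * n)))
        with (2 * (x ^ (8 * n + 1) / (8 * INR n + INR 1))).
      2: { rewrite pow_add. simpl (INR 1). field. lra. }
      apply H.
      - intros y Hy.
        replace (kern y * y ^ (8 * n)) with (kern y - (kern y - kern y * y ^ (8 * n))) by ring.
        apply (is_derive_minus (K := R_AbsRing) (V := R_NormedModule));
          [apply is_derive_kern_prim|apply DT].
      - intros y Hy. apply is_derive_scal. replace (y ^ (8 * n)) with (y ^ (8 * n + 0)) by (f_equal; lia).
        apply Dpow.
      - intros y Hy. pose proof (kern_bounds y). assert (0 <= y ^ (8 * n)) by (apply pow_le; lra).
        rewrite Rabs_pos_eq by (apply Rmult_le_pos; lra).
        apply Rmult_le_compat_r; lra. }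
    assert (Hs : forall n, is_RInt (fun x => sum_lt (fun k => t k x) n) 0 1 (sum_lt s n)).
    { intro n. apply is_RInt_sum_lt. intros k _. pose proof (pos_INR k) as Hk.
      assert (Ip : forall j c, 8 * INR k + INR j + 1 = c ->
        is_RInt (fun x => x ^ (8 * k + j) / c) 0 1 (1 / c ^ 2)).
      { intros j c <-. pose proof (pos_INR j).
        assert (Hi := is_RInt_scal (V := R_NormedModule) _ _ _ (/ (8 * INR k + INR j + 1)) _
                        (is_RInt_pow_unit (8 * k + j))).
        replace (INR (8 * k + j) + 1) with (8 * INR k + INR j + 1) in Hi
          by (rewrite plus_INR, mult_INR; simpl (INR 8); ring).
        replace (1 / (8 * INR k + INR j + 1) ^ 2)
          with (scal (/ (8 * INR k + INR j + 1)) (/ (8 * INR k + INR j + 1)))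
          by (unfold scal; simpl; unfold mult; simpl; field; lra).
        revert Hi. apply is_RInt_ext. intros x _. unfold scal; simpl; unfold mult; simpl.
        unfold Rdiv. ring. }
      assert (I0 := Ip 0%nat (8 * INR k + 1) ltac:(simpl; ring)).
      rewrite Nat.add_0_r in I0.
      exact (is_RInt_minus (V := R_NormedModule) _ _ _ _ _ _
               (is_RInt_minus (V := R_NormedModule) _ _ _ _ _ _
                 (is_RInt_plus (V := R_NormedModule) _ _ _ _ _ _ I0
                   (Ip 2%nat (8 * INR k + 3) ltac:(simpl; ring)))
                 (Ip 4%nat (8 * INR k + 5) ltac:(simpl; ring)))
               (Ip 6%nat (8 * INR k + 7) ltac:(simpl; ring))). }
    apply (is_lim_seq_bound _ (fun n => 2 * / (INR n + 1))).
    2: { replace (Finite 0) with (Rbar_mult 2 0) by (simpl; f_equal; ring).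
         apply is_lim_seq_scal_l, is_lim_seq_inv_INR. }
    intro n. pose proof (pos_INR n) as Hn.
    assert (Hdiff := is_RInt_minus (V := R_NormedModule) _ _ _ _ _ _ (Hs n)
                       (RInt_correct (V := R_CompleteNormedModule) _ _ _ ex_RInt_kern_mean)).
    assert (Hc := is_RInt_const (V := R_NormedModule) 0 1 (2 * / (INR n + 1))).
    replace (2 * / (INR n + 1)) with (scal (1 - 0) (2 * / (INR n + 1)))
      by (unfold scal; simpl; unfold mult; simpl; ring).
    refine (is_RInt_abs_le _ _ _ _ Hdiff Hc _).
    intros x Hx. unfold minus, plus, opp; simpl.
    assert (H := Hpw n x ltac:(lra)).
    rewrite <- HT, <- kern_mean_mul, <- Rmult_minus_distr_l, Rabs_mult, Rabs_pos_eq in H by lra.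
    apply Rmult_le_reg_l in H; [|lra].
    change (Rabs (sum_lt (fun k => t k x) n - kern_mean x) <= 2 * / (INR n + 1)).
    rewrite Rabs_minus_sym. eapply Rle_trans; [exact H|].
    rewrite <- (Rmult_1_r (2 * / (INR n + 1))).
    apply Rmult_le_compat.
    - apply Rdiv_le_0_compat; lra.
    - apply pow_le; lra.
    - apply Rmult_le_compat_l; [lra|]. apply Rinv_le_contravar; lra.
    - rewrite <- (pow1 (8 * n)). apply pow_incr; lra. }
  apply is_lim_seq_unique in L1. apply is_lim_seq_unique in L2.
  rewrite L1 in L2. injection L2 as L2. pose proof trigamma_eighths. lra.
Qed.

(** * The harmonic series *)

(* With [c = sqrt ((1 + f) / 2)], the octic is [quart a x * quart b x] where
   [a^2 = 2 - 2 c] and [b^2 = 2 + 2 c]. *)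
Lemma is_RInt_log_octic (f : R) : -1 < f < 1 ->
  is_RInt (fun x => kern x * ln (1 - 2 * f * x ^ 4 + (x ^ 4) ^ 2)) 0 1
    (PI / sqrt 2 * (ln 2 + ln (1 + sqrt ((1 - f) / 2)) / 2
                    + ln (sqrt 2 + sqrt (1 + sqrt ((1 - f) / 2))))
     - 4 * RInt kern_mean 0 1).
Proof.
  intro Hf. pose proof sqrt2_pos as H2. pose proof sqrt2_sq as H22.
  set (c := sqrt ((1 + f) / 2)). set (s := sqrt ((1 - f) / 2)).
  assert (Hc0 : 0 < c) by (apply sqrt_lt_R0; lra).
  assert (Hs0 : 0 < s) by (apply sqrt_lt_R0; lra).
  assert (Hc2 : c * c = (1 + f) / 2) by (apply sqrt_sqrt; lra).
  assert (Hs2 : s * s = (1 - f) / 2) by (apply sqrt_sqrt; lra).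
  assert (Hc1 : c < 1) by nra.
  set (p := sqrt (1 - c)). set (q := sqrt (1 + c)). set (t := sqrt (1 + s)).
  assert (Hp0 : 0 < p) by (apply sqrt_lt_R0; lra).
  assert (Hq0 : 0 < q) by (apply sqrt_lt_R0; lra).
  assert (Ht0 : 0 < t) by (apply sqrt_lt_R0; lra).
  assert (Hp2 : p * p = 1 - c) by (apply sqrt_sqrt; lra).
  assert (Hq2 : q * q = 1 + c) by (apply sqrt_sqrt; lra).
  assert (Ht2 : t * t = 1 + s) by (apply sqrt_sqrt; lra).
  assert (Hpq : p * q = s).
  { apply Rsqr_inj; [apply Rmult_le_pos; lra|lra|]. unfold Rsqr.
    replace (p * q * (p * q)) with ((p * p) * (q * q)) by ring. rewrite Hp2, Hq2. lra. }
  assert (Hpt : p + q = sqrt 2 * t).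
  { apply Rsqr_inj; [lra|apply Rmult_le_pos; lra|]. unfold Rsqr.
    replace (sqrt 2 * t * (sqrt 2 * t)) with (sqrt 2 ^ 2 * (t * t)) by ring.
    rewrite H22, Ht2. lra. }
  set (a := sqrt 2 * p). set (b := sqrt 2 * q).
  assert (Ha : 0 < a) by (apply Rmult_lt_0_compat; trivial).
  assert (Hb : 0 < b) by (apply Rmult_lt_0_compat; trivial).
  assert (HI := is_RInt_plus (V := R_NormedModule) _ _ _ _ _ _
                  (is_RInt_log_int a Ha) (is_RInt_log_int b Hb)).
  replace (PI / sqrt 2 * (ln 2 + ln (1 + s) / 2 + ln (sqrt 2 + t)) - 4 * RInt kern_mean 0 1)
    with (plus (log_int a) (log_int b)).
  - revert HI. apply is_RInt_ext. intros x _. unfold plus; simpl.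
    rewrite <- Rmult_plus_distr_l, <- ln_mult by (apply quart_pos; trivial).
    f_equal. f_equal. unfold quart, a, b.
    replace ((sqrt 2 * p) ^ 2) with (sqrt 2 ^ 2 * (p * p)) by ring.
    replace ((sqrt 2 * q) ^ 2) with (sqrt 2 ^ 2 * (q * q)) by ring.
    rewrite H22, Hp2, Hq2. replace f with (2 * (c * c) - 1) by lra. ring.
  - unfold plus; simpl. rewrite !log_int_eq by trivial.
    (* By [Hpq] and [Hpt], the product of the two arguments is [2 * (1 + sqrt 2 * t + s)], and
       [s = t^2 - 1] makes this [2 * t * (t + sqrt 2)]. Here [ln t] is [ln (1 + s) / 2]; these are
       the nested radicals of the final formula. *)
    assert (E : ln (a + sqrt 2) + ln (b + sqrt 2) = ln 2 + ln (1 + s) / 2 + ln (sqrt 2 + t)).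
    { rewrite <- Ht2, !ln_mult by trivial.
      replace ((ln t + ln t) / 2) with (ln t) by field.
      rewrite <- !ln_mult by (try apply Rmult_lt_0_compat; lra). f_equal.
      unfold a, b.
      replace ((sqrt 2 * p + sqrt 2) * (sqrt 2 * q + sqrt 2))
        with (sqrt 2 ^ 2 * (1 + (p + q) + p * q)) by ring.
      rewrite H22, Hpt, Hpq. replace s with (t * t - 1) by lra. ring. }
    rewrite <- E. ring.
Qed.

(** One [log_int] comes from [1 + x^4] and two from each octic. These are [m] in all, each
    contributing [-2 * RInt kern_mean 0 1], which explains the factor [m] on the trigamma and
    [PI ^ 2] terms. *)
Lemma is_RInt_log_one_plus_pow (n : nat) :
  let m := (2 * n + 1)%nat in
  is_RInt (fun x => kern x * ln (1 + x ^ (4 * m))) 0 1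
    (INR m / 16 * (trigamma (7 / 8) - trigamma (3 / 8))
     - PI ^ 2 * INR m * sqrt 2 / 8
     + PI * (INR m + 2) * sqrt 2 / 4 * ln 2
     + PI * sqrt 2 / 4 *
       (sum_lt (fun k : nat => ln (1 + sqrt ((1 - phi m k) / 2))) n
        + 2 * sum_lt (fun k : nat =>
                ln (sqrt 2 + sqrt (1 + sqrt ((1 - phi m k) / 2)))) n)).
Proof.
  intro m. pose proof sqrt2_pos as H2. pose proof sqrt2_sq as H22.
  assert (Hphi : forall k, (k < n)%nat -> -1 < phi m k < 1).
  { intros k Hk. assert (Ha := phi_angle n k Hk). fold m in Ha. unfold phi.
    set (t := (2 * INR k + 1) * PI / INR m) in *.
    rewrite <- cos_PI, <- cos_0. split; apply cos_decreasing_1; lra. }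
  assert (H := is_RInt_plus (V := R_NormedModule) _ _ _ _ _ _
                 (is_RInt_log_int (sqrt 2) H2)
                 (is_RInt_sum_lt _ 0 1 _ n (fun k Hk => is_RInt_log_octic (phi m k) (Hphi k Hk)))).
  match type of H with is_RInt _ _ _ ?v => match goal with |- is_RInt _ _ _ ?w =>
    replace w with v end end.
  - revert H. apply is_RInt_ext. intros x Hx.
    rewrite Rmin_left in Hx by lra.
    unfold plus; simpl. rewrite quart_sqrt2, sum_lt_scal, <- Rmult_plus_distr_l. f_equal.
    assert (Hx4 : 0 < x ^ 4) by (apply pow_lt; lra).
    destruct (ln_prod_lt (fun k => 1 - 2 * phi m k * x ^ 4 + (x ^ 4) ^ 2) n) as [P1 P2].
    { intros k Hk. specialize (Hphi k Hk).
      assert (0 < (1 - phi m k) * x ^ 4) by (apply Rmult_lt_0_compat; lra).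
      pose proof (pow2_ge_0 (1 - x ^ 4)). lra. }
    change (ln (1 + x ^ 4) + sum_lt (fun k => ln (1 - 2 * phi m k * x ^ 4 + (x ^ 4) ^ 2)) n
            = ln (1 + x ^ (4 * m))).
    rewrite <- P2, <- ln_mult, pow_mult by (trivial; lra).
    unfold m. rewrite (one_plus_pow_odd n (x ^ 4) Hx4). reflexivity.
  - unfold plus; simpl. rewrite log_int_eq by trivial.
    unfold Rminus at 2. rewrite sum_lt_plus, sum_lt_const.
    rewrite sum_lt_scal, !sum_lt_plus, sum_lt_const.
    replace (sum_lt (fun k => ln (1 + sqrt ((1 - phi m k) / 2)) / 2) n)
      with (/ 2 * sum_lt (fun k => ln (1 + sqrt ((1 - phi m k) / 2))) n)
      by (rewrite <- sum_lt_scal; apply sum_lt_ext; intros; unfold Rdiv; ring).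
    set (A := sum_lt (fun k => ln (1 + sqrt ((1 - phi m k) / 2))) n).
    set (B := sum_lt (fun k => ln (sqrt 2 + sqrt (1 + sqrt ((1 - phi m k) / 2)))) n).
    (* This [3 / 2] and one [ln 2] from each of the [n] octics add up to the coefficient
       [(m + 2) / 2]. *)
    replace (ln (sqrt 2 + sqrt 2)) with (3 / 2 * ln 2).
    2: { replace (sqrt 2 + sqrt 2) with (2 * sqrt 2) by ring.
         rewrite ln_mult by lra.
         assert (E : ln 2 = ln (sqrt 2) + ln (sqrt 2)).
         { rewrite <- ln_mult by trivial. f_equal. rewrite <- H22 at 1. ring. }
         lra. }
    replace (PI / sqrt 2) with (PI * sqrt 2 / 2).
    2: { replace (PI * sqrt 2 / 2) with (PI * sqrt 2 ^ 2 / (2 * sqrt 2)) by (field; lra).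
         rewrite H22. field. lra. }
    assert (Hm : INR m = 2 * INR n + 1) by (unfold m; rewrite plus_INR, mult_INR; reflexivity).
    rewrite Hm. assert (HQ := RInt_kern_mean). set (Q := RInt kern_mean 0 1) in *.
    replace Q with ((PI ^ 2 * sqrt 2 / 8 - (trigamma (7 / 8) - trigamma (3 / 8)) / 16) / 2)
      by lra.
    field.
Qed.

(** * Partial sums of the harmonic series and their remainders *)

Definition ln_taylor (n : nat) (y : R) : R :=
  sum_lt (fun j => (-1) ^ j * (y ^ S j / (INR j + 1))) n.

(** The derivative of the error is the geometric remainder [(-1)^n * t^n / (1 + t)], of absolute
    value at most [t^n]. *)
Lemma ln_taylor_error (n : nat) (y : R) : 0 <= y ->
  Rabs (ln (1 + y) - ln_taylor n y) <= y ^ S n / (INR n + 1).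
Proof.
  intro Hy. pose proof (pos_INR n) as Hn.
  set (d := fun y => / (1 + y) - sum_lt (fun j => (-1) ^ j * y ^ j) n).
  assert (Hd : forall t, 0 <= t -> d t = (-1) ^ n * t ^ n / (1 + t)).
  { intros t Ht. unfold d. clear - Ht. induction n as [|n IH].
    - unfold sum_lt; simpl. field. lra.
    - rewrite sum_lt_S.
      replace (/ (1 + t) - (sum_lt (fun j => (-1) ^ j * t ^ j) n + (-1) ^ n * t ^ n))
        with (/ (1 + t) - sum_lt (fun j => (-1) ^ j * t ^ j) n - (-1) ^ n * t ^ n) by ring.
      rewrite IH. simpl. field. lra. }
  assert (H := abs_le_of_derive (fun y => ln (1 + y) - ln_taylor n y)
                 (fun y => y ^ S n / (INR n + 1)) d (fun y => y ^ n) 0 y Hy).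
  cbv beta in H.
  assert (E0 : ln_taylor n 0 = 0).
  { unfold ln_taylor. rewrite (sum_lt_ext _ (fun _ => 0)); [rewrite sum_lt_const; ring|].
    intros j _. rewrite pow_i by lia. unfold Rdiv. ring. }
  rewrite E0 in H.
  rewrite (pow_i (S n)), Rplus_0_r, ln_1 in H by lia.
  replace (ln (1 + y) - ln_taylor n y - (0 - 0)) with (ln (1 + y) - ln_taylor n y) in H by ring.
  replace (y ^ S n / (INR n + 1) - 0 / (INR n + 1)) with (y ^ S n / (INR n + 1)) in H
    by (field; lra).
  apply H.
  - intros t Ht. unfold d.
    apply (is_derive_minus (K := R_AbsRing) (V := R_NormedModule) (fun y => ln (1 + y))).
    + auto_derive; [lra|field; lra].
    + apply (is_derive_sum_lt (fun j y => (-1) ^ j * (y ^ S j / (INR j + 1)))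
               (fun j y => (-1) ^ j * y ^ j)).
      intros j _. apply is_derive_scal, is_derive_pow_div. reflexivity.
  - intros t _. apply is_derive_pow_div. reflexivity.
  - intros t Ht. rewrite Hd by lra.
    assert (Htn : 0 <= t ^ n) by (apply pow_le; lra).
    unfold Rdiv. rewrite !Rabs_mult, pow_1_abs, Rmult_1_l, (Rabs_pos_eq (t ^ n)) by trivial.
    rewrite Rabs_pos_eq by (apply Rlt_le, Rinv_0_lt_compat; lra).
    rewrite <- (Rmult_1_r (t ^ n)) at 2. apply Rmult_le_compat_l; [trivial|].
    rewrite <- Rinv_1. apply Rinv_le_contravar; lra.
Qed.

Lemma harmonic_S (n : nat) : harmonic (S n) = harmonic n + / (INR n + 1).
Proof. unfold harmonic. rewrite sum_lt_S, plus_INR. reflexivity. Qed.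

(** The remainder only asks for growth slower than [n]. The square root makes the induction
    algebraic: [1 / (n + 1) <= 2 * (sqrt (n + 1) - sqrt n)]. *)
Lemma harmonic_bounds (n : nat) : 0 <= harmonic n <= 2 * sqrt (INR n).
Proof.
  induction n as [|n IH].
  - unfold harmonic, sum_lt; simpl. rewrite sqrt_0. lra.
  - rewrite harmonic_S, S_INR. pose proof (pos_INR n) as Hn.
    assert (H0 : 0 < / (INR n + 1)) by (apply Rinv_0_lt_compat; lra).
    set (u := sqrt (INR n)) in *. set (v := sqrt (INR n + 1)).
    assert (Hu : u * u = INR n) by (apply sqrt_sqrt; lra).
    assert (Hv : v * v = INR n + 1) by (apply sqrt_sqrt; lra).
    assert (Hv0 : 0 < v) by (apply sqrt_lt_R0; lra).
    assert (Hu0 : 0 <= u) by apply sqrt_pos.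
    assert (H1 : / (INR n + 1) <= 2 * (v - u)).
    { rewrite <- Hv. apply Rmult_le_reg_r with (v * v); [nra|].
      rewrite Rinv_l by nra.
      assert (Huv : u <= v) by nra. assert (1 <= v) by nra.
      assert (E : (v - u) * (v + u) = 1) by lra.
      assert ((v - u) * (v + u) <= (v - u) * (2 * v)) by (apply Rmult_le_compat_l; lra).
      assert ((v - u) * (2 * v) * 1 <= (v - u) * (2 * v) * v)
        by (apply Rmult_le_compat_l; [apply Rmult_le_pos; lra|lra]).
      lra. }
    lra.
Qed.

(** Multiplying by [1 + y] takes differences of consecutive harmonic numbers, which are the Taylor
    coefficients of [ln (1 + y)] up to sign. The boundary term is the part that does not tend to 0
    at [y = 1]. *)
Lemma harmonic_gen_sum (n : nat) (y : R) :
  (1 + y) * sum_lt (fun j => (-1) ^ j * harmonic (S j) * y ^ S j) n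
  = ln_taylor n y - (-1) ^ n * harmonic n * y ^ S n.
Proof.
  unfold ln_taylor. induction n as [|n IH].
  - unfold harmonic, sum_lt; simpl. ring.
  - rewrite !sum_lt_S, Rmult_plus_distr_l, IH, harmonic_S. pose proof (pos_INR n).
    simpl. field. lra.
Qed.

Lemma alternating_geom_sum (m : nat) (y : R) : Nat.Odd m ->
  (1 + y) * sum_lt (fun p => (-1) ^ p * y ^ p) m = 1 + y ^ m.
Proof.
  intro Hm.
  assert (H : forall m, (1 + y) * sum_lt (fun p => (-1) ^ p * y ^ p) m = 1 - (-1) ^ m * y ^ m).
  { clear. induction m as [|m IH].
    - unfold sum_lt; simpl. ring.
    - rewrite sum_lt_S, Rmult_plus_distr_l, IH. simpl. ring. }
  rewrite H. destruct Hm as [n ->]. rewrite pow_add, pow_1_even. ring.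
Qed.

(** The two fractions are integrals of powers of [x], and for odd [m] the alternating sum of
    [x^(4p)] is [(1 + x^(4m)) / (1 + x^4)]. Its denominator gives [kern], and its numerator is the
    factor [1 + y] that [harmonic_gen_sum] calls for. *)
Lemma is_RInt_term (m j : nat) : Nat.Odd m ->
  is_RInt (fun x => kern x * (1 + x ^ (4 * m))
                    * ((-1) ^ j * harmonic (S j) * (x ^ (4 * m)) ^ S j)) 0 1
    ((-1) ^ (S j + 1) * harmonic (S j) *
     sum_lt (fun p : nat =>
       (-1) ^ p / (4 * INR m * INR (S j) + 4 * INR p + 3) +
       (-1) ^ p / (4 * INR m * INR (S j) + 4 * INR p + 1)) m).
Proof.
  intro Hm.
  assert (HI : forall p, (p < m)%nat ->
    is_RInt (fun x => (-1) ^ p * (x ^ (4 * m * S j + 4 * p + 2) + x ^ (4 * m * S j + 4 * p)))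
      0 1 ((-1) ^ p / (4 * INR m * INR (S j) + 4 * INR p + 3) +
           (-1) ^ p / (4 * INR m * INR (S j) + 4 * INR p + 1))).
  { intros p _.
    assert (H := is_RInt_scal (V := R_NormedModule) _ _ _ ((-1) ^ p) _
                   (is_RInt_plus (V := R_NormedModule) _ _ _ _ _ _
                      (is_RInt_pow_unit (4 * m * S j + 4 * p + 2)%nat)
                      (is_RInt_pow_unit (4 * m * S j + 4 * p)%nat))).
    match type of H with is_RInt _ _ _ ?v => match goal with |- is_RInt _ _ _ ?w =>
      replace w with v end end; [exact H|].
    change ((-1) ^ p * (/ (INR (4 * m * S j + 4 * p + 2)%nat + 1)
                        + / (INR (4 * m * S j + 4 * p)%nat + 1))
            = (-1) ^ p / (4 * INR m * INR (S j) + 4 * INR p + 3) +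
              (-1) ^ p / (4 * INR m * INR (S j) + 4 * INR p + 1)).
    rewrite !plus_INR, !mult_INR. replace (INR 4) with 4 by (simpl; ring).
    change (INR 2) with 2. unfold Rdiv. rewrite Rmult_plus_distr_l.
    replace (4 * INR m * INR (S j) + 4 * INR p + 2 + 1)
      with (4 * INR m * INR (S j) + 4 * INR p + 3) by ring.
    reflexivity. }
  assert (H := is_RInt_scal (V := R_NormedModule) _ _ _ ((-1) ^ (S j + 1) * harmonic (S j)) _
                 (is_RInt_sum_lt _ 0 1 _ m HI)).
  revert H. apply is_RInt_ext. intros x _.
  set (h := harmonic (S j)).
  change ((-1) ^ (S j + 1) * h *
    sum_lt (fun p => (-1) ^ p * (x ^ (4 * m * S j + 4 * p + 2) + x ^ (4 * m * S j + 4 * p))) m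
    = kern x * (1 + x ^ (4 * m)) * ((-1) ^ j * h * (x ^ (4 * m)) ^ S j)).
  rewrite (sum_lt_ext _ (fun p => (x ^ (4 * m)) ^ S j * (1 + x ^ 2) * ((-1) ^ p * (x ^ 4) ^ p))).
  2: { intros p _. rewrite <- !pow_mult, !pow_add. ring. }
  rewrite sum_lt_scal, (pow_mult x 4 m), <- (alternating_geom_sum m (x ^ 4) Hm).
  unfold kern. pose proof (one_plus_pow4_pos x).
  replace (S j + 1)%nat with (2 + j)%nat by lia. rewrite (pow_add (-1) 2 j).
  field. lra.
Qed.

(* [is_series] sums from index 0, hence n := S j. *)
Theorem theorem3p3 (m : nat) (hm1 : (1 <= m)%nat) (hm : Nat.Odd m) :
  is_series
    (fun j : nat =>
       let n := S j in
       (-1) ^ (n + 1) * harmonic n *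
       sum_lt (fun p : nat =>
         (-1) ^ p / (4 * INR m * INR n + 4 * INR p + 3) +
         (-1) ^ p / (4 * INR m * INR n + 4 * INR p + 1)) m)
    (INR m / 16 * (trigamma (7 / 8) - trigamma (3 / 8))
     - PI ^ 2 * INR m * sqrt 2 / 8
     + PI * (INR m + 2) * sqrt 2 / 4 * ln 2
     + PI * sqrt 2 / 4 *
       (sum_lt (fun k : nat =>
          ln (1 + sqrt ((1 - phi m k) / 2))) ((m - 1) / 2)
        + 2 * sum_lt (fun k : nat =>
          ln (sqrt 2 + sqrt (1 + sqrt ((1 - phi m k) / 2)))) ((m - 1) / 2))).
Proof.
  assert (Hn : exists n, m = (2 * n + 1)%nat /\ ((m - 1) / 2)%nat = n).
  { destruct hm as [n ->]. exists n. split; [reflexivity|].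
    rewrite Nat.add_sub, Nat.mul_comm. apply Nat.div_mul. discriminate. }
  destruct Hn as (n & Em & En). rewrite En.
  assert (HI := is_RInt_log_one_plus_pow n). cbv zeta in HI. rewrite <- Em in HI.
  match goal with |- is_series _ ?v => set (V := v) in * end.
  apply is_series_sum_lt. cbv zeta.
  (* The integrated error is at most [(2 + 2 * harmonic N) / (N + 1)]. With [v = sqrt (N + 1)] and
     [harmonic N <= 2 * v], this is at most [(2 + 4 * v) / v^2 <= 6 / v]. *)
  apply (is_lim_seq_bound _ (fun N => 6 * sqrt (/ (INR N + 1)))).
  - intro N. pose proof (pos_INR N) as HN. pose proof (harmonic_bounds N) as HH.
    assert (Hd := is_RInt_minus (V := R_NormedModule) _ _ _ _ _ _
                    (is_RInt_sum_lt _ 0 1 _ N (fun j _ => is_RInt_term m j hm)) HI).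
    assert (Hb := is_RInt_scal (V := R_NormedModule) _ _ _ (2 + 2 * harmonic N) _
                    (is_RInt_pow_unit N)).
    eapply Rle_trans; [refine (is_RInt_abs_le _ _ _ _ Hd Hb _)|].
    + intros x Hx. set (y := x ^ (4 * m)).
      change (Rabs (sum_lt (fun j => kern x * (1 + y) * ((-1) ^ j * harmonic (S j) * y ^ S j)) N
                    - kern x * ln (1 + y)) <= (2 + 2 * harmonic N) * x ^ N).
      assert (Hy : 0 < y) by (apply pow_lt; lra).
      rewrite sum_lt_scal, Rmult_assoc, harmonic_gen_sum, <- Rmult_minus_distr_l, Rabs_mult.
      (* A crude comparison, enough because the integral of [x^N] is [1 / (N + 1)], which already
         outweighs [harmonic N]. *)
      assert (HyN : 0 < y ^ S N <= x ^ N).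
      { split; [apply pow_lt, Hy|]. unfold y. rewrite <- pow_mult.
        replace (4 * m * S N)%nat with (N + (4 * m * S N - N))%nat by nia.
        rewrite pow_add. rewrite <- (Rmult_1_r (x ^ N)) at 2.
        apply Rmult_le_compat_l; [apply pow_le; lra|].
        rewrite <- (pow1 (4 * m * S N - N)). apply pow_incr; lra. }
      pose proof (kern_bounds x) as Hk. rewrite (Rabs_pos_eq (kern x)) by lra.
      assert (HL := ln_taylor_error N y (Rlt_le _ _ Hy)).
      assert (HL' : y ^ S N / (INR N + 1) <= x ^ N).
      { apply Rle_trans with (y ^ S N * 1); [|lra].
        apply Rmult_le_compat_l; [lra|]. rewrite <- Rinv_1. apply Rinv_le_contravar; lra. }
      assert (HE : Rabs (ln_taylor N y - (-1) ^ N * harmonic N * y ^ S N - ln (1 + y))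
                   <= (1 + harmonic N) * x ^ N).
      { replace (ln_taylor N y - (-1) ^ N * harmonic N * y ^ S N - ln (1 + y))
          with (- (ln (1 + y) - ln_taylor N y) + - ((-1) ^ N * harmonic N * y ^ S N)) by ring.
        eapply Rle_trans; [apply Rabs_triang|]. rewrite !Rabs_Ropp, !Rabs_mult, pow_1_abs.
        rewrite (Rabs_pos_eq (harmonic N)), (Rabs_pos_eq (y ^ S N)) by lra.
        assert (harmonic N * y ^ S N <= harmonic N * x ^ N) by (apply Rmult_le_compat_l; lra).
        lra. }
      replace ((2 + 2 * harmonic N) * x ^ N) with (2 * ((1 + harmonic N) * x ^ N)) by ring.
      apply Rmult_le_compat; try lra. apply Rabs_pos.
    + change ((2 + 2 * harmonic N) * / (INR N + 1) <= 6 * sqrt (/ (INR N + 1))).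
      rewrite sqrt_inv. set (v := sqrt (INR N + 1)).
      assert (Hv0 : 1 <= v) by (rewrite <- sqrt_1; apply sqrt_le_1; lra).
      assert (Hv : v * v = INR N + 1) by (apply sqrt_sqrt; lra).
      assert (Huv : sqrt (INR N) <= v) by (apply sqrt_le_1; lra).
      rewrite <- Hv, Rinv_mult. rewrite <- Rmult_assoc.
      apply Rmult_le_compat_r; [apply Rlt_le, Rinv_0_lt_compat; lra|].
      apply Rmult_le_reg_r with v; [lra|]. rewrite Rmult_assoc, Rinv_l by lra. lra.
  - replace (Finite 0) with (Rbar_mult 6 0) by (simpl; f_equal; ring).
    apply is_lim_seq_scal_l.
    apply (filterlim_comp _ _ _ (fun N => / (INR N + 1)) sqrt _ (locally 0)).
    + apply is_lim_seq_inv_INR.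
    + rewrite <- sqrt_0 at 2. apply continuous_sqrt.
Qed.
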